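(* Let $a>0$, let $\kappa\ge\tfrac12$ be real, let $p_1,p_2\in C([0,a])$ be complex-valued with $p_1(0)\ne0$, and let $q\in C((0,a])$ be complex-valued with $|q(x)|\le c_qx^\alpha$ for $x\in(0,a]$, for some $c_q>0$ and some $-1<\alpha\le0$. Let $$f_0(x)=x^\kappa,\qquad g_0(x)=-x^{-\kappa}\int_0^xt^{2\kappa}p_1(t)\,dt,$$ which is a solution $(u,v)=(f_0,g_0)$ of $v'+p_1u+\frac{\kappa}{x}v=0$, $-u'+\frac{\kappa}{x}u=0$, and let $\widehat X_q^{(n)},\widehat Y_q^{(n)}$, $n\ge0$, be the functions constructed from $(f_0,g_0)$ as defined in the context. Then the solution $(u,v)=(f_q,g_q)$ of the system $$v'+p_1u+\Big(\frac{\kappa}{x}+q\Big)v=0,\qquad -u'+\Big(\frac{\kappa}{x}+q\Big)u+p_2v=0,\qquad x\in(0,a],$$ that satisfies the asymptotics $$f_q(x)\sim x^\kappa,\qquad g_q(x)\sim\frac{-p_1(0)}{2\kappa+1}x^{\kappa+1},\qquad x\to0,$$ is given by the (convergent) series $$\begin{pmatrix}f_q\\ g_q\end{pmatrix}=\sum_{n=0}^\infty\frac1{n!}\begin{pmatrix}\widehat X_q^{(n)}\\ \widehat Y_q^{(n)}\end{pmatrix}.$$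
   Context: Recursive functions: $\widehat X_q^{(0)}=f_0$, $\widehat Y_q^{(0)}=g_0$, and for $n\ge0$ and $x\in(0,a]$, $$\widehat Z_q^{(n)}(x)=\int_0^x\Big(-\widehat X_q^{(n)}(t)g_0(t)q(t)+\widehat Y_q^{(n)}(t)\big(-f_0(t)q(t)-g_0(t)p_2(t)\big)\Big)dt,$$ $$\widehat X_q^{(n+1)}(x)=(n+1)f_0(x)\int_0^x\Big(\frac{q(t)}{f_0(t)}\widehat X_q^{(n)}(t)+\frac{p_2(t)}{f_0(t)}\widehat Y_q^{(n)}(t)\Big)dt,$$ $$\widehat Y_q^{(n+1)}(x)=(n+1)\frac1{f_0(x)}\widehat Z_q^{(n)}(x)+\frac{g_0(x)}{f_0(x)}\widehat X_q^{(n+1)}(x).$$ Here $f_1(x)\sim f_2(x)$, $x\to0$, means $f_1(x)=f_2(x)[1+o(1)]$ as $x\to0$. Solutions are functions continuously differentiable on $(0,a]$. *)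

(* Defs.v *)
From Stdlib Require Import Reals.
From Coquelicot Require Import Coquelicot.

Open Scope R_scope.

Definition half_open (a x : R) : Prop := 0 < x <= a.
Definition closed_itv (a x : R) : Prop := 0 <= x <= a.

Definition continuous_onC (D : R -> Prop) (f : R -> C) : Prop :=
  @continuous_on R_UniformSpace C_UniformSpace D f.

(* The derivative is taken within [D] (hence one-sided at an endpoint
   belonging to [D]), so that values of [f] outside [D] are irrelevant. *)
Definition C1_on (D : R -> Prop) (f df : R -> C) : Prop :=
  (forall x, D x ->
     @filterdiff R_AbsRing R_NormedModule C_R_NormedModule
       f (within D (locally x)) (fun h => Cmult (RtoC h) (df x))) /\
  continuous_onC D df.

Definition is_dirac_solution (a kappa : R) (p1 p2 q : R -> C) (u v : R -> C)
  : Prop :=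
  exists du dv : R -> C,
    C1_on (half_open a) u du /\ C1_on (half_open a) v dv /\
    forall x, half_open a x ->
      (dv x + p1 x * u x + (RtoC (kappa / x) + q x) * v x = 0)%C /\
      (- du x + (RtoC (kappa / x) + q x) * u x + p2 x * v x = 0)%C.

(* f1(x) = f2(x) [1 + o(1)] as x -> 0, x > 0 *)
Definition asymp0 (f1 f2 : R -> C) : Prop :=
  exists o : R -> C,
    @filterlim R C o (at_right 0) (@locally C_UniformSpace (RtoC 0)) /\
    at_right 0 (fun x => f1 x = (f2 x * (1 + o x))%C).

(* Improper at 0: the integrands below are continuous on (0,a] but may be
   unbounded near 0.  The integrand is only ever evaluated at t > 0, so the
   Stdlib convention [Rpower 0 y = 1] plays no role. *)
Definition int0 (f : R -> C) (x : R) : C :=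
  @RInt_gen C_R_CompleteNormedModule f (at_right 0) (at_point x).

Definition f0 (kappa : R) (x : R) : C := RtoC (Rpower x kappa).

Definition g0 (kappa : R) (p1 : R -> C) (x : R) : C :=
  (- RtoC (Rpower x (- kappa))
     * int0 (fun t => RtoC (Rpower t (2 * kappa)) * p1 t) x)%C.

Definition Zstep (f g p2 q : R -> C) (X Y : R -> C) (x : R) : C :=
  int0 (fun t => - X t * g t * q t + Y t * (- f t * q t - g t * p2 t))%C x.

Definition Xstep (f p2 q : R -> C) (n : nat) (X Y : R -> C) (x : R) : C :=
  (RtoC (INR (S n)) * f x
     * int0 (fun t => q t / f t * X t + p2 t / f t * Y t) x)%C.

Definition Ystep (f g p2 q : R -> C) (n : nat) (X Y : R -> C) (x : R) : C :=
  (RtoC (INR (S n)) * (1 / f x) * Zstep f g p2 q X Y x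
     + g x / f x * Xstep f p2 q n X Y x)%C.

Fixpoint XYhat (f g p2 q : R -> C) (n : nat) : (R -> C) * (R -> C) :=
  match n with
  | O => (f, g)
  | S m => let (X, Y) := XYhat f g p2 q m in
           (Xstep f p2 q m X Y, Ystep f g p2 q m X Y)
  end.

Definition Xhat (f g p2 q : R -> C) (n : nat) : R -> C :=
  fst (XYhat f g p2 q n).
Definition Yhat (f g p2 q : R -> C) (n : nat) : R -> C :=
  snd (XYhat f g p2 q n).

(* Main.v *)
Require Import Defs.
From Stdlib Require Import Reals Factorial Lra Lia.
From Coquelicot Require Import Coquelicot.
Open Scope R_scope.

(** Put [A = x^(-kappa) u] and [B = x^kappa v].  The system becomes
    [A' = q A + x^(-2 kappa) p2 B], [B' = - (q B + x^(2 kappa) p1 A)], and the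
    normalised functions [A_n = Xhat_n / (n! f0)], [B_n = f0 Yhat_n / n!] satisfy
    [A_(n+1)' = q A_n + x^(-2 kappa) p2 B_n],
    [B_(n+1)' = - (q B_n + x^(2 kappa) p1 A_(n+1))] and vanish at [0]: they are the
    Picard iterates of this integral system started at [A_0 = 1].  With
    [w = K x^(1 + alpha)], [K] large, comparing derivatives gives inductively
    [|A_n| <= w^n / n!] and [|B_n| <= M x^(2 kappa + 1) w^n / n!].  The same
    comparison identifies the sum of the series as a solution and, applied to the
    difference of two solutions with the same asymptotics, gives uniqueness. *)

(** The coefficient [x^(-2 kappa)] is not integrable at [0], since [2 kappa >= 1]. A constant bound
    on [B] is therefore useless: only the weight [x^(2 kappa + 1)] in the bound on [B] turns
    [x^(-2 kappa) p2 B] into a term of size [x |A|], which can be added to [|q|] in the derivative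
    of [w]. Each iteration gains the factor [w / (n + 1)] in both components because the equation
    for [B_(n+1)] contains the new [A_(n+1)]. With [A_n] in its place, [x^(2 kappa) p1 A_n] would
    integrate to size [x^(2 kappa + 1) w^n], without the extra power of [w]. So every estimate
    treats [A] first and then feeds the improved bound to [B]. The improper integral [int0] is a
    total operator and says nothing by itself about convergence. It is therefore always evaluated
    through a primitive that vanishes at [0], and such a primitive is obtained by comparison with an
    explicit majorant. *)

Lemma norm_Cmod (z : C) : @norm R_AbsRing C_R_NormedModule z = Cmod z.
Proof.
unfold norm; simpl; unfold prod_norm, Cmod; simpl; unfold norm; simpl; unfold abs; simpl.
f_equal; rewrite !Rmult_1_r, <- !Rabs_mult, !Rabs_pos_eq; try apply Rle_0_sqr; reflexivity.
Qed.

Lemma Cmod_Rmult (r : R) (z : C) : 0 <= r -> Cmod (RtoC r * z) = r * Cmod z.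
Proof. intros Hr; rewrite Cmod_mult, Cmod_R, Rabs_pos_eq; trivial. Qed.

(** * Limits, continuity and derivatives on (0, a] *)

(** The non-strict inequality lets estimates conclude directly; [tends_filterlim] shows the
    equivalence with [filterlim]. *)
Definition tends {T : Type} (F : (T -> Prop) -> Prop) (f : T -> C) (l : C) : Prop :=
  forall eps, 0 < eps -> F (fun y => Cmod (f y - l) <= eps).

Lemma tends_filterlim {T : Type} (F : (T -> Prop) -> Prop) {FF : Filter F} f l :
  tends F f l <-> @filterlim T C f F (@locally C_UniformSpace l).
Proof.
split.
- intros H; apply (@filterlim_locally_ball_norm R_AbsRing T C_R_NormedModule F FF f l); intros eps.
  generalize (H (eps / 2) (is_pos_div_2 eps)); apply filter_imp; intros y Hy.
  unfold ball_norm; rewrite norm_Cmod.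
  change (Cmod (f y - l) < eps); generalize (cond_pos eps); lra.
- intros H eps Heps.
  generalize (proj1 (@filterlim_locally_ball_norm R_AbsRing T C_R_NormedModule F FF f l) H
    (mkposreal eps Heps)).
  apply filter_imp; intros y; unfold ball_norm; rewrite norm_Cmod; simpl; intros Hy.
  change (Cmod (f y - l) < eps) in Hy; lra.
Qed.

Lemma tends_ext {T : Type} (F : (T -> Prop) -> Prop) {FF : Filter F} f g l :
  F (fun y => f y = g y) -> tends F f l -> tends F g l.
Proof.
intros E H eps Heps; generalize (filter_and (F := F) _ _ E (H eps Heps)); apply filter_imp.
intros y [<- Hy]; exact Hy.
Qed.

Lemma tends_const {T : Type} (F : (T -> Prop) -> Prop) {FF : Filter F} l : tends F (fun _ => l) l.
Proof.
intros eps Heps; apply filter_forall; intros _.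
replace (l - l)%C with (RtoC 0) by ring; rewrite Cmod_0; lra.
Qed.

Lemma tends_plus {T : Type} (F : (T -> Prop) -> Prop) {FF : Filter F} f g l m :
  tends F f l -> tends F g m -> tends F (fun y => f y + g y)%C (l + m)%C.
Proof.
intros Hf Hg eps Heps.
generalize (filter_and (F := F) _ _ (Hf (eps / 2) ltac:(lra)) (Hg (eps / 2) ltac:(lra))).
apply filter_imp; intros y [H1 H2].
replace (f y + g y - (l + m))%C with ((f y - l) + (g y - m))%C by ring.
eapply Rle_trans; [apply Cmod_triangle | lra].
Qed.

Lemma tends_mult {T : Type} (F : (T -> Prop) -> Prop) {FF : Filter F} f g l m :
  tends F f l -> tends F g m -> tends F (fun y => f y * g y)%C (l * m)%C.
Proof.
intros Hf Hg eps Heps.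
assert (Hl := Cmod_ge_0 l); assert (Hm := Cmod_ge_0 m).
(* Adding 1 keeps the divisors positive when a limit is 0; in [e1] it also covers [g y], which is
   within 1 of [m]. *)
set (e1 := eps / (2 * (Cmod m + 1))); set (e2 := eps / (2 * (Cmod l + 1))).
assert (He1 : 0 < e1) by (apply Rdiv_lt_0_compat; lra).
assert (He2 : 0 < e2) by (apply Rdiv_lt_0_compat; lra).
generalize (filter_and (F := F) _ _ (Hf e1 He1)
  (filter_and (F := F) _ _ (Hg 1 Rlt_0_1) (Hg e2 He2))).
apply filter_imp; intros y [H1 [H2 H3]].
replace (f y * g y - l * m)%C with ((f y - l) * (m + (g y - m)) + l * (g y - m))%C by ring.
eapply Rle_trans; [apply Cmod_triangle | rewrite !Cmod_mult].
assert (Cmod (m + (g y - m))%C <= Cmod m + 1)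
  by (eapply Rle_trans; [apply Cmod_triangle | lra]).
replace eps with (e1 * (Cmod m + 1) + (Cmod l + 1) * e2)
  by (unfold e1, e2; field; lra).
apply Rplus_le_compat; apply Rmult_le_compat; try apply Cmod_ge_0; lra.
Qed.

Lemma tends_opp {T : Type} (F : (T -> Prop) -> Prop) {FF : Filter F} f l :
  tends F f l -> tends F (fun y => - f y)%C (- l)%C.
Proof.
intros H eps Heps; generalize (H eps Heps); apply filter_imp; intros y Hy.
replace (- f y - - l)%C with (- (f y - l))%C by ring; rewrite Cmod_opp; exact Hy.
Qed.

Lemma tends_minus {T : Type} (F : (T -> Prop) -> Prop) {FF : Filter F} f g l m :
  tends F f l -> tends F g m -> tends F (fun y => f y - g y)%C (l - m)%C.
Proof. intros Hf Hg; exact (tends_plus F _ _ _ _ Hf (tends_opp F _ _ Hg)). Qed.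

Lemma tends_squeeze {T : Type} (F : (T -> Prop) -> Prop) {FF : Filter F} f g :
  F (fun y => Cmod (f y) <= Cmod (g y)) -> tends F g 0 -> tends F f 0.
Proof.
intros E H eps Heps; generalize (filter_and (F := F) _ _ E (H eps Heps)); apply filter_imp.
intros y [H1 H2]; replace (f y - 0)%C with (f y) by ring.
replace (g y - 0)%C with (g y) in H2 by ring; lra.
Qed.

Lemma tends_RtoC {T : Type} (F : (T -> Prop) -> Prop) {FF : Filter F} (h : T -> R) l :
  filterlim h F (locally l) -> tends F (fun y => RtoC (h y)) (RtoC l).
Proof.
intros H eps Heps.
generalize (proj1 (filterlim_locally h l) H (mkposreal eps Heps)); apply filter_imp.
intros y Hy; rewrite <- RtoC_minus, Cmod_R.
apply Rlt_le; exact Hy.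
Qed.

Notation near a x := (within (half_open a) (@locally R_UniformSpace x)).

Definition cont (a : R) (f : R -> C) : Prop :=
  forall x, half_open a x -> tends (near a x) f (f x).

Lemma cont_onC a f : cont a f <-> continuous_onC (half_open a) f.
Proof.
split; intros H x Hx.
- exact (proj1 (tends_filterlim (near a x) f (f x)) (H x Hx)).
- exact (proj2 (tends_filterlim (near a x) f (f x)) (H x Hx)).
Qed.

Lemma near_self a x : near a x (half_open a).
Proof. apply (filter_forall (F := @locally R_UniformSpace x)); intros y Hy; exact Hy. Qed.

Lemma cont_ext a f g : (forall x, half_open a x -> f x = g x) -> cont a f -> cont a g.
Proof.
intros E H x Hx; rewrite <- (E x Hx); apply (tends_ext (near a x) f); [ | apply H; trivial].
eapply filter_imp; [ | apply near_self]; apply E.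
Qed.

Lemma cont_const a c : cont a (fun _ => c).
Proof. intros x Hx; apply (tends_const (near a x)). Qed.

Lemma cont_plus a f g : cont a f -> cont a g -> cont a (fun x => f x + g x)%C.
Proof. intros Hf Hg x Hx; apply tends_plus; auto; apply _. Qed.

Lemma cont_mult a f g : cont a f -> cont a g -> cont a (fun x => f x * g x)%C.
Proof. intros Hf Hg x Hx; apply tends_mult; auto; apply _. Qed.

Lemma cont_opp a f : cont a f -> cont a (fun x => - f x)%C.
Proof. intros Hf x Hx; apply tends_opp; auto; apply _. Qed.

Lemma cont_RtoC a (h : R -> R) :
  (forall x, 0 < x -> continuous h x) -> cont a (fun x => RtoC (h x)).
Proof.
intros H x Hx; apply (tends_RtoC (near a x)).
eapply filterlim_filter_le_1; [ | apply H, Hx].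
apply filter_le_within.
Qed.

(* Derivative relative to (0, a], hence one-sided at [a]. *)
Definition der (a : R) (f : R -> C) (x : R) (l : C) : Prop :=
  forall eps, 0 < eps ->
    near a x (fun y => Cmod (f y - f x - RtoC (y - x) * l) <= eps * Rabs (y - x)).

Lemma der_filterdiff a f x l : half_open a x ->
  der a f x l <-> @filterdiff R_AbsRing R_NormedModule C_R_NormedModule
       f (near a x) (fun h => Cmult (RtoC h) l).
Proof.
intros Hx; split.
- intros H; split.
  + eapply (is_linear_ext (fun k => @scal R_AbsRing C_R_NormedModule k l)).
    2: apply is_linear_scal_l.
    intros k; exact (scal_R_Cmult k l).
  + intros z Hz eps.
    assert (z = x) as ->.
    { apply (@is_filter_lim_unique R_AbsRing R_NormedModule (near a x)).
      2: exact Hz.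
      2: { intros P HP; apply filter_le_within; exact HP. }
      (* The relative neighbourhood filter is proper because [x] itself lies in (0, a]; limits along
         it are therefore unique. *)
      split; [ | apply _].
      intros [d Hd]; exact (Hd x (ball_center x d) Hx). }
    generalize (H eps (cond_pos eps)); apply filter_imp; intros y.
    rewrite norm_Cmod; exact (fun h => h).
- intros [_ H] eps Heps.
  generalize (H x ltac:(intros P HP; apply filter_le_within; exact HP) (mkposreal eps Heps)).
  apply filter_imp; intros y; rewrite norm_Cmod; exact (fun h => h).
Qed.

Lemma der_is_derive a (f : R -> C) x l :
  @is_derive R_AbsRing C_R_NormedModule f x l -> der a f x l.
Proof.
intros [_ H] eps Heps.
generalize (H x (fun P HP => HP) (mkposreal eps Heps)).
intros H1; apply filter_le_within; revert H1.
apply filter_imp; intros y; rewrite norm_Cmod.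
rewrite scal_R_Cmult; exact (fun h => h).
Qed.

Lemma der_RtoC a (h : R -> R) x l : is_derive h x l -> der a (fun y => RtoC (h y)) x (RtoC l).
Proof.
intros [_ H] eps Heps.
generalize (H x (fun P HP => HP) (mkposreal eps Heps)).
intros H1; apply filter_le_within; revert H1.
apply filter_imp; intros y.
rewrite <- RtoC_mult, <- !RtoC_minus, Cmod_R; exact (fun h => h).
Qed.

Lemma der_ext a f g x l : half_open a x ->
  (forall y, half_open a y -> f y = g y) -> der a f x l -> der a g x l.
Proof.
intros Hx E H eps Heps; generalize (filter_and (F := near a x) _ _ (near_self a x) (H eps Heps)).
apply filter_imp; intros y [Hy Hyy]; rewrite <- !E; trivial.
Qed.

Lemma der_const a c x : der a (fun _ => c) x 0.
Proof.
intros eps Heps; apply filter_forall; intros y.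
replace (c - c - RtoC (y - x) * 0)%C with (RtoC 0) by ring; rewrite Cmod_0.
apply Rmult_le_pos; [lra | apply Rabs_pos].
Qed.

Lemma der_plus a f g x l m : der a f x l -> der a g x m ->
  der a (fun y => f y + g y)%C x (l + m)%C.
Proof.
intros Hf Hg eps Heps.
generalize (filter_and (F := near a x) _ _ (Hf (eps / 2) ltac:(lra)) (Hg (eps / 2) ltac:(lra))).
apply filter_imp; intros y [H1 H2].
replace (f y + g y - (f x + g x) - RtoC (y - x) * (l + m))%C
  with ((f y - f x - RtoC (y - x) * l) + (g y - g x - RtoC (y - x) * m))%C by ring.
eapply Rle_trans; [apply Cmod_triangle | lra].
Qed.

Lemma der_opp a f x l : der a f x l -> der a (fun y => - f y)%C x (- l)%C.
Proof.
intros H eps Heps; generalize (H eps Heps); apply filter_imp; intros y Hy.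
replace (- f y - - f x - RtoC (y - x) * - l)%C
  with (- (f y - f x - RtoC (y - x) * l))%C by ring.
rewrite Cmod_opp; exact Hy.
Qed.

Lemma der_minus a f g x l m : der a f x l -> der a g x m ->
  der a (fun y => f y - g y)%C x (l - m)%C.
Proof. intros Hf Hg; exact (der_plus _ _ _ _ _ _ Hf (der_opp _ _ _ _ Hg)). Qed.

Lemma der_tends a f x l : der a f x l -> tends (near a x) f (f x).
Proof.
intros H eps Heps; assert (Hl := Cmod_ge_0 l).
set (d := eps / (Cmod l + 1)).
assert (Hd : 0 < d) by (apply Rdiv_lt_0_compat; lra).
assert (Hn : near a x (fun y => Rabs (y - x) < d)).
{ apply filter_le_within; exists (mkposreal d Hd); intros y Hy; exact Hy. }
generalize (filter_and (F := near a x) _ _ Hn (H 1 Rlt_0_1)); apply filter_imp; intros y [H1 H2].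
replace (f y - f x)%C with ((f y - f x - RtoC (y - x) * l) + RtoC (y - x) * l)%C by ring.
eapply Rle_trans; [apply Cmod_triangle | rewrite (Cmod_mult (RtoC (y - x))), Cmod_R].
replace eps with (d * (Cmod l + 1)) by (unfold d; field; lra).
assert (H3 := Rabs_pos (y - x)); nra.
Qed.

Lemma der_cont a f df : (forall x, half_open a x -> der a f x (df x)) -> cont a f.
Proof. intros H x Hx; eapply der_tends; auto. Qed.

Lemma der_mult a f g x l m : der a f x l -> der a g x m ->
  der a (fun y => f y * g y)%C x (l * g x + f x * m)%C.
Proof.
intros Hf Hg eps Heps.
assert (Hl := Cmod_ge_0 l); assert (Hgx := Cmod_ge_0 (g x)); assert (Hfx := Cmod_ge_0 (f x)).
set (e1 := eps / (3 * (Cmod (g x) + 1))); set (e2 := eps / (3 * (Cmod (f x) + 1))).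
set (e3 := eps / (3 * (Cmod l + 1))).
assert (He1 : 0 < e1) by (apply Rdiv_lt_0_compat; lra).
assert (He2 : 0 < e2) by (apply Rdiv_lt_0_compat; lra).
assert (He3 : 0 < e3) by (apply Rdiv_lt_0_compat; lra).
generalize (filter_and (F := near a x) _ _ (filter_and (F := near a x) _ _ (Hf e1 He1) (Hg e2 He2))
  (filter_and (F := near a x) _ _ (der_tends _ _ _ _ Hg 1 Rlt_0_1) (der_tends _ _ _ _ Hg e3 He3))).
apply filter_imp; intros y [[H1 H2] [H3 H4]].
(* The summands pair the linearisation error of [f] with [g y], that of [g] with [f x], and the
   increment of [g] with [l]; each receives a third of [eps]. *)
replace (f y * g y - f x * g x - RtoC (y - x) * (l * g x + f x * m))%C
  with ((f y - f x - RtoC (y - x) * l) * (g x + (g y - g x))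
        + (f x * (g y - g x - RtoC (y - x) * m)
           + RtoC (y - x) * (l * (g y - g x))))%C by ring.
assert (H5 : Cmod (g x + (g y - g x))%C <= Cmod (g x) + 1)
  by (eapply Rle_trans; [apply Cmod_triangle | lra]).
replace (eps * Rabs (y - x)) with
  ((e1 * Rabs (y - x)) * (Cmod (g x) + 1) + ((Cmod (f x) + 1) * (e2 * Rabs (y - x))
    + Rabs (y - x) * ((Cmod l + 1) * e3))) by (unfold e1, e2, e3; field; lra).
eapply Rle_trans; [apply Cmod_triangle | apply Rplus_le_compat].
{ rewrite Cmod_mult; apply Rmult_le_compat; try apply Cmod_ge_0; lra. }
eapply Rle_trans; [apply Cmod_triangle | apply Rplus_le_compat].
{ rewrite Cmod_mult; apply Rmult_le_compat; try apply Cmod_ge_0; lra. }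
rewrite !Cmod_mult, Cmod_R; apply Rmult_le_compat_l; [apply Rabs_pos | ].
apply Rmult_le_compat; try apply Cmod_ge_0; lra.
Qed.

(* Freezing [f] beyond [a] lets the two-sided theorems of Coquelicot apply up to the
   endpoint [a]. *)
Lemma continuous_truncate a f t : cont a f -> 0 < a -> 0 < t ->
  @continuous R_UniformSpace C_UniformSpace (fun s => f (Rmin s a)) t.
Proof.
intros Hf Ha Ht; unfold continuous.
assert (Hm : half_open a (Rmin t a)) by (split; [apply Rmin_glb_lt; trivial | apply Rmin_r]).
apply (filterlim_comp _ _ _ (fun s => Rmin s a) f _ (near a (Rmin t a))).
2: exact (proj1 (tends_filterlim (near a (Rmin t a)) f _) (Hf _ Hm)).
intros P [d Hd].
assert (H0 : 0 < Rmin d t) by (apply Rmin_glb_lt; [apply cond_pos | trivial]).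
exists (mkposreal _ H0); intros s Hs.
assert (Hs1 : Rabs (s - t) < Rmin d t) by exact Hs.
assert (H1 := Rmin_l d t); assert (H2 := Rmin_r d t).
apply Rabs_def2 in Hs1.
apply Hd.
- change (Rabs (Rmin s a - Rmin t a) < d).
  apply Rabs_def1; unfold Rmin; destruct (Rle_dec s a); destruct (Rle_dec t a); lra.
- split; [apply Rmin_glb_lt; lra | apply Rmin_r].
Qed.

(** At an interior point (0, a] contains a full neighbourhood, so the relative derivative is a
    two-sided one. *)
Lemma der_Re a G x l : 0 < x < a -> der a G x l -> is_derive (fun t => Re (G t)) x (Re l).
Proof.
intros Hx H; split; [apply is_linear_scal_l | ].
intros z Hz eps.
assert (z = x) as ->.
{ symmetry; apply (@is_filter_lim_locally_unique R_AbsRing R_NormedModule); exact Hz. }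
assert (Hn : locally x (half_open a)).
{ assert (H0 : 0 < Rmin x (a - x)) by (apply Rmin_glb_lt; lra).
  exists (mkposreal _ H0); intros y Hy.
  assert (Hy1 : Rabs (y - x) < Rmin x (a - x)) by exact Hy.
  assert (H1 := Rmin_l x (a - x)); assert (H2 := Rmin_r x (a - x)).
  apply Rabs_def2 in Hy1; split; lra. }
generalize (filter_and (F := locally x) _ _ Hn (H eps (cond_pos eps))).
apply filter_imp; intros y [Hy1 Hy2]; specialize (Hy2 Hy1).
eapply Rle_trans; [ | exact Hy2].
eapply Rle_trans; [ | apply re_le_Cmod].
apply Req_le; change (Rabs (Re (G y) - Re (G x) - (y - x) * Re l)
  = Rabs (Re (G y - G x - RtoC (y - x) * l)%C)); f_equal.
destruct (G y), (G x), l; simpl; ring.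
Qed.

(** The rotation that sends [z] to the positive real axis. It reduces complex estimates to real
    ones; asking only for [Cmod th <= 1] allows [th = 0] when [z = 0]. *)
Lemma Cmod_Re_witness (z : C) : exists th : C, Cmod th <= 1 /\ Re (th * z)%C = Cmod z.
Proof.
destruct (Req_dec (Cmod z) 0) as [H | H].
- exists 0%C; rewrite Cmod_0, H; split; [lra | destruct z; simpl; ring].
- assert (Hc : RtoC (Cmod z) <> 0%C) by (intros E; apply H; exact (f_equal fst E)).
  exists (Cconj z / RtoC (Cmod z))%C; split.
  + rewrite Cmod_div, Cmod_R, Cmod_conj, Rabs_pos_eq by (trivial; apply Cmod_ge_0).
    apply Req_le; field; trivial.
  + replace (Cconj z / RtoC (Cmod z) * z)%C with (RtoC (Cmod z)); [reflexivity | ].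
    replace (Cconj z / RtoC (Cmod z) * z)%C with ((z * Cconj z) / RtoC (Cmod z))%C
      by (field; trivial).
    rewrite <- Cmod2_conj, RtoC_pow; field; trivial.
Qed.

(** Mean value inequality for complex functions: with [th] the rotation of the fixed number
    [F x - F y], the real function [Re (th * F) - h] has a derivative [<= 0], and the real mean
    value theorem applies. *)
Lemma der_le a (F dF : R -> C) (h dh : R -> R) :
  (forall x, half_open a x -> der a F x (dF x)) ->
  (forall x, half_open a x -> is_derive h x (dh x)) ->
  (forall x, half_open a x -> Cmod (dF x) <= dh x) ->
  forall x y, 0 < y <= x -> x <= a -> Cmod (F x - F y)%C <= h x - h y.
Proof.
intros HF Hh Hb x y Hy Hxa.
destruct (Cmod_Re_witness (F x - F y)%C) as [th [Hth Hz]].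
set (G := fun t => (th * F t - RtoC (h t))%C).
assert (HG : forall t, half_open a t -> der a G t (th * dF t - RtoC (dh t))%C).
{ intros t Ht.
  replace (th * dF t - RtoC (dh t))%C with ((0 * F t + th * dF t) - RtoC (dh t))%C by ring.
  apply der_minus; [ | apply der_RtoC, Hh, Ht].
  apply (der_mult a (fun _ => th) F); [apply der_const | auto]. }
assert (HcG := der_cont _ _ _ HG).
destruct (MVT_gen (fun t => Re (G (Rmin t a))) y x
  (fun t => Re (th * dF t - RtoC (dh t))%C)) as [c [Hc E]].
- intros t Ht; rewrite Rmin_left in Ht by lra; rewrite Rmax_right in Ht by lra.
  eapply is_derive_ext_loc; [ | apply (der_Re a G); [lra | apply HG; split; lra]].
  assert (H0 : 0 < a - t) by lra.
  exists (mkposreal _ H0); intros s Hs.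
  assert (Hs1 : Rabs (s - t) < a - t) by exact Hs.
  apply Rabs_def2 in Hs1; rewrite Rmin_left; [reflexivity | lra].
- intros t Ht; rewrite Rmin_left in Ht by lra; rewrite Rmax_right in Ht by lra.
  apply continuity_pt_filterlim.
  apply (filterlim_comp _ _ _ (fun s => G (Rmin s a)) fst _ (@locally C_UniformSpace (G (Rmin t a)))).
  + apply (continuous_truncate a G t HcG); lra.
  + apply (@continuous_fst R_UniformSpace R_UniformSpace).
- rewrite Rmin_left in Hc by lra; rewrite Rmax_right in Hc by lra.
  rewrite !Rmin_left in E by lra.
  assert (H1 : Re (th * dF c - RtoC (dh c))%C <= 0).
  { replace (Re (th * dF c - RtoC (dh c))%C) with (Re (th * dF c)%C - dh c)
      by (destruct (th * dF c)%C; simpl; ring).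
    assert (Cmod (th * dF c)%C <= dh c).
    { rewrite Cmod_mult; assert (H2 := Hb c ltac:(split; lra)).
      assert (H3 := Cmod_ge_0 (dF c)); nra. }
    assert (H2 := re_le_Cmod (th * dF c)%C); apply Rabs_le_between in H2; lra. }
  assert (H2 : Re (G x) - Re (G y) <= 0) by (rewrite E; nra).
  assert (H3 : Re (G x) - Re (G y) = Re (th * (F x - F y))%C - (h x - h y))
    by (unfold G; destruct th, (F x), (F y); simpl; ring).
  rewrite Hz in H3; lra.
Qed.

(** * Primitives vanishing at 0 *)

Notation vanishes f := (tends (at_right 0) f 0).

Lemma at_right_below b : 0 < b -> at_right 0 (fun y => 0 < y < b).
Proof.
intros Hb; exists (mkposreal b Hb); intros y Hy Hy0.
assert (H : Rabs (y - 0) < b) by exact Hy.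
apply Rabs_def2 in H; lra.
Qed.

(** Let [y] tend to [0] in [der_le]: [F y] disappears and [- h y] is at most 0. This is the
    comparison principle behind all later bounds. *)
Lemma der_bound a (F dF : R -> C) (h dh : R -> R) :
  (forall x, half_open a x -> der a F x (dF x)) ->
  (forall x, half_open a x -> is_derive h x (dh x)) ->
  (forall x, half_open a x -> Cmod (dF x) <= dh x) ->
  (forall x, half_open a x -> 0 <= h x) ->
  vanishes F ->
  forall x, half_open a x -> Cmod (F x) <= h x.
Proof.
intros HF Hh Hb Hp H0 x Hx; apply le_epsilon; intros eps Heps.
destruct (filter_ex _ (filter_and (F := at_right 0) _ _
  (H0 eps Heps) (at_right_below x (proj1 Hx)))) as [y [H1 H2]].
replace (F y - 0)%C with (F y) in H1 by ring.
assert (H3 := der_le a F dF h dh HF Hh Hb x y ltac:(lra) (proj2 Hx)).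
assert (H4 := Hp y ltac:(unfold half_open in *; lra)).
replace (F x) with (F x - F y + F y)%C by ring.
eapply Rle_trans; [apply Cmod_triangle | lra].
Qed.

(** On [[y, x]] with [y > 0] the integrand is continuous and the integral is [F x - F y]; then [y]
    tends to [0], where [F] vanishes. *)
Lemma int0_primitive a F f :
  (forall x, half_open a x -> der a F x (f x)) -> cont a f -> vanishes F ->
  forall x, half_open a x -> int0 f x = F x.
Proof.
intros HF Hf H0 x Hx; assert (Ha : 0 < a) by (unfold half_open in Hx; lra).
assert (HI : forall y, 0 < y < x ->
  @is_RInt C_R_NormedModule f y x (F x - F y)%C).
{ intros y Hy.
  set (ft := fun s => f (Rmin s a)).
  assert (Hcf : forall t, 0 < t -> @continuous R_UniformSpace C_R_NormedModule ft t).
  { intros t Ht; exact (continuous_truncate a f t Hf Ha Ht). }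
  set (P := fun s : R => @RInt C_R_CompleteNormedModule ft x s : C).
  assert (HP : forall s, 0 < s -> @is_RInt C_R_NormedModule ft x s (P s)).
  { intros s Hs; apply (@RInt_correct C_R_CompleteNormedModule).
    apply (@ex_RInt_continuous C_R_CompleteNormedModule); intros z Hz; apply Hcf.
    assert (0 < Rmin x s) by (apply Rmin_glb_lt; [apply Hx | trivial]); lra. }
  assert (HdP : forall s, half_open a s -> der a P s (f s)).
  { intros s Hs; apply der_is_derive.
    replace (f s) with (ft s) by (unfold ft; rewrite Rmin_left; [trivial | apply Hs]).
    apply (@is_derive_RInt C_R_NormedModule ft P x s); [ | apply Hcf, Hs].
    exists (mkposreal s (proj1 Hs)); intros u Hu; apply HP.
    assert (Hu1 : Rabs (u - s) < s) by exact Hu; apply Rabs_def2 in Hu1; lra. }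
  (* [P] and [F] have the same derivative, so [der_le] with the zero majorant makes their difference
     constant. *)
  assert (HPF : Cmod ((P x - F x) - (P y - F y))%C <= 0 - 0).
  { apply (der_le a (fun s => P s - F s)%C (fun _ => 0%C) (fun _ => 0) (fun _ => 0)).
    - intros s Hs; replace (RtoC 0) with (f s - f s)%C by ring.
      apply der_minus; auto.
    - intros s Hs; apply @is_derive_const.
    - intros; rewrite Cmod_0; lra.
    - lra.
    - apply Hx. }
  assert (E : ((P x - F x) - (P y - F y))%C = 0%C).
  { apply Cmod_eq_0; generalize (Cmod_ge_0 ((P x - F x) - (P y - F y))%C); lra. }
  assert (EPx : P x = RtoC 0) by (unfold P; rewrite RInt_point; reflexivity).
  replace (F x - F y)%C with (- P y)%C.
  2: { replace (- P y)%C with ((P x - F x) - (P y - F y) + (F x - F y) - P x)%C by ring.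
       rewrite E, EPx; ring. }
  apply (@is_RInt_ext C_R_NormedModule ft).
  - intros s Hs; rewrite Rmax_right in Hs by lra.
    unfold ft; rewrite Rmin_left; [trivial | unfold half_open in Hx; lra].
  - apply (@is_RInt_swap C_R_NormedModule), HP, Hy. }
unfold int0; apply (@is_RInt_gen_unique C_R_CompleteNormedModule (at_right 0) (at_point x)
  (Proper_StrongProper _ (at_right_proper_filter 0))
  (Proper_StrongProper _ (at_point_filter x)) f (F x)).
intros Q HQ.
assert (HT : tends (at_right 0) (fun y => F x - F y)%C (F x)).
{ generalize (tends_minus (at_right 0) _ _ _ _ (tends_const (at_right 0) (F x)) H0).
  replace (F x - 0)%C with (F x) by ring; trivial. }
assert (HQ1 := proj1 (tends_filterlim (at_right 0) _ _) HT Q HQ).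
apply (Filter_prod _ _ _ (fun y => 0 < y < x /\ Q (F x - F y)%C) (fun z => z = x)).
- apply (filter_and (F := at_right 0)); [apply at_right_below, Hx | exact HQ1].
- reflexivity.
- intros y z [Hy Hyq] ->; exists (F x - F y)%C; split; [apply HI; trivial | trivial].
Qed.

(** Integrate from [a], away from the singularity, and subtract the limit at [0]. The limit exists
    by the Cauchy criterion, as the increments of the integral are at most those of [h], which tends
    to [0]. *)
Lemma primitive_exists a f (h dh : R -> R) :
  0 < a -> cont a f ->
  (forall x, half_open a x -> is_derive h x (dh x)) ->
  (forall x, half_open a x -> Cmod (f x) <= dh x) ->
  vanishes (fun x => RtoC (h x)) ->
  exists F, (forall x, half_open a x -> der a F x (f x)) /\ vanishes F.
Proof.
intros Ha Hf Hh Hb H0.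
set (ft := fun s => f (Rmin s a)).
assert (Hcf : forall t, 0 < t -> @continuous R_UniformSpace C_R_NormedModule ft t).
{ intros t Ht; exact (continuous_truncate a f t Hf Ha Ht). }
set (P := fun s : R => @RInt C_R_CompleteNormedModule ft a s : C).
assert (HdP : forall s, half_open a s -> der a P s (f s)).
{ intros s Hs; apply der_is_derive.
  replace (f s) with (ft s) by (unfold ft; rewrite Rmin_left; [trivial | apply Hs]).
  apply (@is_derive_RInt C_R_NormedModule ft P a s); [ | apply Hcf, Hs].
  exists (mkposreal s (proj1 Hs)); intros u Hu.
  assert (Hu1 : Rabs (u - s) < s) by exact Hu; apply Rabs_def2 in Hu1.
  apply (@RInt_correct C_R_CompleteNormedModule).
  apply (@ex_RInt_continuous C_R_CompleteNormedModule); intros z Hz; apply Hcf.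
  assert (0 < Rmin a u) by (apply Rmin_glb_lt; lra); lra. }
assert (Hle := der_le a P f h dh HdP Hh Hb).
destruct (proj1 (@filterlim_locally_cauchy R C_R_CompleteNormedModule (at_right 0)
  (at_right_proper_filter 0) P)) as [L HL].
- intros eps.
  (* Two values of [h] bounded by [eps / 4] differ by at most [eps / 2], which leaves room for the
     strict inequality of the Cauchy criterion. *)
  exists (fun y => half_open a y /\ Rabs (h y) <= eps / 4); split.
  + generalize (filter_and (F := at_right 0) _ _ (at_right_below a Ha)
      (H0 (eps / 4) ltac:(generalize (cond_pos eps); lra))).
    apply filter_imp; intros y [H1 H2]; split; [unfold half_open; lra | ].
    rewrite <- RtoC_minus, Cmod_R, Rminus_0_r in H2; exact H2.
  + assert (Hw : forall u v, u <= v -> half_open a u -> half_open a v ->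
      Rabs (h u) <= eps / 4 -> Rabs (h v) <= eps / 4 -> Cmod (P v - P u)%C < eps).
    { intros u v Huv Hu Hv H1 H2; apply Rabs_le_between in H1; apply Rabs_le_between in H2.
      assert (H3 := Hle v u ltac:(unfold half_open in *; lra) (proj2 Hv)).
      generalize (cond_pos eps); lra. }
    intros u v [Hu Hhu] [Hv Hhv]; apply (@norm_compat1 R_AbsRing C_R_NormedModule).
    rewrite norm_Cmod; change (Cmod (P v - P u)%C < eps).
    destruct (Rle_dec u v) as [Huv | Huv]; [apply Hw; trivial | ].
    replace (P v - P u)%C with (- (P u - P v))%C by ring.
    rewrite Cmod_opp; apply Hw; trivial; lra.
- exists (fun x => P x - L)%C; split.
  + intros x Hx; replace (f x) with (f x - 0)%C by ring.
    apply (der_minus a P (fun _ => L)); [auto | apply der_const].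
  + assert (HT : tends (at_right 0) P L) by exact (proj2 (tends_filterlim (at_right 0) P L) HL).
    replace (RtoC 0) with (L - L)%C by ring.
    apply (tends_minus (at_right 0) P (fun _ => L)); [trivial | apply (tends_const (at_right 0))].
Qed.

(** * Reduction to the scaled system *)

Lemma is_derive_Rpower c x : 0 < x ->
  is_derive (fun t => Rpower t c) x (c * Rpower x (c - 1)).
Proof. intros Hx; apply is_derive_Reals, derivable_pt_lim_power, Hx. Qed.

Lemma continuous_Rpower c x : 0 < x -> continuous (fun t => Rpower t c) x.
Proof.
intros Hx; apply @ex_derive_continuous; eexists; apply is_derive_Rpower, Hx.
Qed.

Lemma Rpower_gt0 x c : 0 < Rpower x c.
Proof. apply exp_pos. Qed.

Lemma Rpower_vanishes c : 0 < c -> vanishes (fun x => RtoC (Rpower x c)).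
Proof.
intros Hc eps Heps; assert (H1 := at_right_below (Rpower eps (/ c)) (Rpower_gt0 _ _)).
revert H1; apply filter_imp; intros x Hx.
rewrite <- RtoC_minus, Cmod_R, Rminus_0_r, Rabs_pos_eq by apply Rlt_le, Rpower_gt0.
replace eps with (Rpower (Rpower eps (/ c)) c).
- apply Rle_Rpower_l; lra.
- rewrite Rpower_mult; replace (/ c * c) with 1 by (field; lra); apply Rpower_1, Heps.
Qed.

Lemma Rpower_opp_C c x : (RtoC (Rpower x (- c)) * RtoC (Rpower x c))%C = 1%C.
Proof.
rewrite <- RtoC_mult, <- Rpower_plus, Rplus_opp_l.
unfold Rpower; rewrite Rmult_0_l, exp_0; reflexivity.
Qed.

Lemma der_Rpower a c x : half_open a x ->
  der a (fun t => RtoC (Rpower t c)) x (RtoC (c / x) * RtoC (Rpower x c))%C.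
Proof.
intros [Hx _]; rewrite <- RtoC_mult.
replace (c / x * Rpower x c) with (c * Rpower x (c - 1)).
- apply der_RtoC, is_derive_Rpower, Hx.
- unfold Rminus; rewrite Rpower_plus, Rpower_Ropp, Rpower_1 by trivial; field; lra.
Qed.

Lemma cont_Rpower a c : cont a (fun t => RtoC (Rpower t c)).
Proof. apply cont_RtoC; intros; apply continuous_Rpower; trivial. Qed.

(** Linear in the pair [(A, B)], hence usable for iterates, partial sums, remainders and differences
    of solutions alike. *)
Definition dA kappa (p2 q A B : R -> C) x : C :=
  (q x * A x + RtoC (Rpower x (- (2 * kappa))) * p2 x * B x)%C.
Definition dB kappa (p1 q A B : R -> C) x : C :=
  (- (q x * B x + RtoC (Rpower x (2 * kappa)) * p1 x * A x))%C.

Lemma dirac_of_scaled a kappa p1 p2 q A B u v :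
  cont a p1 -> cont a p2 -> cont a q ->
  (forall x, half_open a x -> der a A x (dA kappa p2 q A B x)) ->
  (forall x, half_open a x -> der a B x (dB kappa p1 q A B x)) ->
  (forall x, half_open a x -> u x = RtoC (Rpower x kappa) * A x)%C ->
  (forall x, half_open a x -> v x = RtoC (Rpower x (- kappa)) * B x)%C ->
  is_dirac_solution a kappa p1 p2 q u v.
Proof.
intros Hp1 Hp2 Hq HA HB Hu Hv.
(* The derivatives are read off from the system, so the equations hold by [ring]; what remains is
   that [u] and [v] really have these derivatives, where the product rule produces the [kappa / x]
   terms. *)
set (du := fun x => ((RtoC (kappa / x) + q x) * u x + p2 x * v x)%C).
set (dv := fun x => (- (p1 x * u x + (RtoC (kappa / x) + q x) * v x))%C).
assert (Hdu : forall x, half_open a x -> der a u x (du x)).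
{ intros x Hx; apply (der_ext a (fun x => RtoC (Rpower x kappa) * A x)%C); trivial.
  - intros y Hy; symmetry; auto.
  - replace (du x) with (RtoC (kappa / x) * RtoC (Rpower x kappa) * A x
      + RtoC (Rpower x kappa) * dA kappa p2 q A B x)%C.
    + apply (der_mult a (fun t => RtoC (Rpower t kappa)) A); [apply der_Rpower | apply HA]; trivial.
    + unfold du, dA; rewrite Hu, Hv by trivial.
      replace (- (2 * kappa)) with (- kappa + - kappa) by ring.
      rewrite Rpower_plus, RtoC_mult.
      transitivity (RtoC (kappa / x) * RtoC (Rpower x kappa) * A x
        + q x * RtoC (Rpower x kappa) * A x
        + (RtoC (Rpower x (- kappa)) * RtoC (Rpower x kappa)) * (RtoC (Rpower x (- kappa)) * p2 x * B x))%C;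
      [ | rewrite Rpower_opp_C]; ring. }
assert (Hdv : forall x, half_open a x -> der a v x (dv x)).
{ intros x Hx; apply (der_ext a (fun x => RtoC (Rpower x (- kappa)) * B x)%C); trivial.
  - intros y Hy; symmetry; auto.
  - replace (dv x) with (RtoC (- kappa / x) * RtoC (Rpower x (- kappa)) * B x
      + RtoC (Rpower x (- kappa)) * dB kappa p1 q A B x)%C.
    + apply (der_mult a (fun t => RtoC (Rpower t (- kappa))) B); [apply der_Rpower | apply HB]; trivial.
    + unfold dv, dB; rewrite Hu, Hv by trivial.
      replace (2 * kappa) with (kappa + kappa) by ring.
      replace (- kappa / x) with (- (kappa / x)) by (unfold Rdiv; ring).
      rewrite Rpower_plus, RtoC_mult, RtoC_opp.
      transitivity (- RtoC (kappa / x) * RtoC (Rpower x (- kappa)) * B x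
        - q x * RtoC (Rpower x (- kappa)) * B x
        - (RtoC (Rpower x (- kappa)) * RtoC (Rpower x kappa)) * (RtoC (Rpower x kappa) * p1 x * A x))%C;
      [ | rewrite Rpower_opp_C]; ring. }
assert (Hk : cont a (fun x => RtoC (kappa / x) + q x)%C).
{ apply cont_plus; trivial; apply cont_RtoC; intros x Hx.
  apply @ex_derive_continuous; auto_derive; lra. }
assert (Hcu := der_cont _ _ _ Hdu); assert (Hcv := der_cont _ _ _ Hdv).
exists du, dv; split; [ | split].
- split.
  + intros x Hx; apply der_filterdiff; auto.
  + apply cont_onC, cont_plus; apply cont_mult; trivial.
- split.
  + intros x Hx; apply der_filterdiff; auto.
  + apply cont_onC, cont_opp, cont_plus; apply cont_mult; trivial.
- intros x Hx; unfold du, dv; split; ring.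
Qed.

Lemma scaled_of_dirac a kappa p1 p2 q u v :
  is_dirac_solution a kappa p1 p2 q u v ->
  let A := fun x => (RtoC (Rpower x (- kappa)) * u x)%C in
  let B := fun x => (RtoC (Rpower x kappa) * v x)%C in
  forall x, half_open a x ->
    der a A x (dA kappa p2 q A B x) /\ der a B x (dB kappa p1 q A B x).
Proof.
intros [du [dv [[Hu _] [[Hv _] H]]]] A B x Hx.
assert (Hdu := proj2 (der_filterdiff a u x (du x) Hx) (Hu x Hx)).
assert (Hdv := proj2 (der_filterdiff a v x (dv x) Hx) (Hv x Hx)).
destruct (H x Hx) as [E1 E2].
split.
- replace (dA kappa p2 q A B x) with (RtoC (- kappa / x) * RtoC (Rpower x (- kappa)) * u x
    + RtoC (Rpower x (- kappa)) * du x)%C.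
  + apply (der_mult a (fun t => RtoC (Rpower t (- kappa))) u); [apply der_Rpower | ]; trivial.
  + replace (du x) with ((RtoC (kappa / x) + q x) * u x + p2 x * v x)%C
      by (transitivity (du x + (- du x + (RtoC (kappa / x) + q x) * u x + p2 x * v x))%C;
          [ring | rewrite E2; ring]).
    unfold A, B, dA.
    replace (- (2 * kappa)) with (- kappa + - kappa) by ring.
    replace (- kappa / x) with (- (kappa / x)) by (unfold Rdiv; ring).
    rewrite Rpower_plus, RtoC_mult, RtoC_opp.
    transitivity (q x * (RtoC (Rpower x (- kappa)) * u x)
      + (RtoC (Rpower x (- kappa)) * RtoC (Rpower x kappa)) * (RtoC (Rpower x (- kappa)) * p2 x * v x))%C;
    [rewrite Rpower_opp_C | ]; ring.
- replace (dB kappa p1 q A B x) with (RtoC (kappa / x) * RtoC (Rpower x kappa) * v x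
    + RtoC (Rpower x kappa) * dv x)%C.
  + apply (der_mult a (fun t => RtoC (Rpower t kappa)) v); [apply der_Rpower | ]; trivial.
  + replace (dv x) with (- (p1 x * u x + (RtoC (kappa / x) + q x) * v x))%C
      by (transitivity (dv x - (dv x + p1 x * u x + (RtoC (kappa / x) + q x) * v x))%C;
          [ring | rewrite E1; ring]).
    unfold A, B, dB.
    replace (2 * kappa) with (kappa + kappa) by ring.
    rewrite Rpower_plus, RtoC_mult.
    transitivity (- (q x * (RtoC (Rpower x kappa) * v x))
      - (RtoC (Rpower x (- kappa)) * RtoC (Rpower x kappa)) * (RtoC (Rpower x kappa) * p1 x * u x))%C;
    [rewrite Rpower_opp_C | ]; ring.
Qed.

(** * Asymptotics and series *)

(** Near [0] the limit bounds [f] by [Cmod l + 1]; on the remaining compact interval a continuous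
    function attains its maximum. *)
Lemma cont_bounded a f l : 0 < a -> cont a f -> tends (at_right 0) f l ->
  exists N, 0 < N /\ forall x, half_open a x -> Cmod (f x) <= N.
Proof.
intros Ha Hf Hl; destruct (Hl 1 Rlt_0_1) as [d Hd].
set (b := Rmin (d / 2) a).
assert (Hb : 0 < b) by (apply Rmin_glb_lt; [apply is_pos_div_2 | trivial]).
assert (Hba : b <= a) by apply Rmin_r.
destruct (continuity_ab_maj (fun s => Cmod (f (Rmin s a))) b a Hba) as [s0 [Hs _]].
- intros c Hc; apply continuity_pt_filterlim.
  apply (filterlim_ext (fun s => @norm R_AbsRing C_R_NormedModule (f (Rmin s a)))).
  { intros s; apply norm_Cmod. }
  rewrite <- norm_Cmod.
  apply (filterlim_comp _ _ _ (fun s => f (Rmin s a)) (@norm R_AbsRing C_R_NormedModule) _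
    (@locally C_UniformSpace (f (Rmin c a)))).
  + apply (continuous_truncate a f c Hf Ha); lra.
  + apply (@filterlim_norm R_AbsRing C_R_NormedModule).
- assert (H1 := Cmod_ge_0 l); assert (H2 := Cmod_ge_0 (f (Rmin s0 a))).
  exists (Cmod l + 1 + Cmod (f (Rmin s0 a))); split; [lra | ].
  intros x Hx; destruct (Rlt_dec x b) as [Hxb | Hxb].
  + assert (Cmod (f x - l)%C <= 1).
    { apply Hd; [ | apply Hx]; change (Rabs (x - 0) < d).
      assert (H3 := Rmin_l (d / 2) a); fold b in H3; generalize (cond_pos d); intros Hd0.
      rewrite Rabs_pos_eq; unfold half_open in Hx; lra. }
    replace (f x) with (f x - l + l)%C by ring.
    eapply Rle_trans; [apply Cmod_triangle | lra].
  + assert (H3 := Hs x ltac:(unfold half_open in Hx; lra)); simpl in H3.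
    rewrite (Rmin_left x a) in H3 by apply Hx; lra.
Qed.

(** Lets the comparison principle be applied on a short interval next to [0], where limits have
    become effective. *)
Lemma der_restrict a b f x l : b <= a -> der a f x l -> der b f x l.
Proof.
intros Hba H eps Heps; generalize (H eps Heps); apply (filter_imp (F := @locally R_UniformSpace x)); intros y Hy Hyb.
apply Hy; unfold half_open in *; lra.
Qed.

(** The [o(1)] factor is recovered as the quotient by [c * x^k] minus 1, which needs [c <> 0]. For
    the second component this is where [p1 0 <> 0] enters. *)
Lemma asymp0_tends u (c : C) k : c <> 0%C ->
  asymp0 u (fun x => c * RtoC (Rpower x k))%C <->
  tends (at_right 0) (fun x => RtoC (Rpower x (- k)) * u x)%C c.
Proof.
intros Hc; split.
- intros [o [Ho E]].
  apply (proj2 (tends_filterlim (at_right 0) o 0)) in Ho.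
  apply (tends_ext (at_right 0) (fun x => c * (1 + o x))%C).
  + revert E; apply filter_imp; intros x ->.
    transitivity (RtoC (Rpower x (- k)) * RtoC (Rpower x k) * (c * (1 + o x)))%C;
      [rewrite Rpower_opp_C | ]; ring.
  + generalize (tends_mult (at_right 0) _ _ _ _ (tends_const (at_right 0) c)
      (tends_plus (at_right 0) _ _ _ _ (tends_const (at_right 0) (RtoC 1)) Ho)).
    replace (c * (1 + 0))%C with c by ring; trivial.
- intros H; exists (fun x => RtoC (Rpower x (- k)) * u x / c - 1)%C; split.
  + apply (proj1 (tends_filterlim (at_right 0) _ 0)).
    replace (RtoC 0) with (c * / c - 1)%C by (field; trivial).
    apply (tends_minus (at_right 0)); [ | apply (tends_const (at_right 0))].
    apply (tends_mult (at_right 0)); [trivial | apply (tends_const (at_right 0))].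
  + apply filter_forall; intros x.
    transitivity (RtoC (Rpower x (- k)) * RtoC (Rpower x k) * u x)%C;
      [rewrite Rpower_opp_C; ring | field; trivial].
Qed.

Lemma asymp0_ext f1 f2 g : (forall x, f1 x = f2 x) -> asymp0 g f1 -> asymp0 g f2.
Proof.
intros E [o [Ho H]]; exists o; split; trivial.
revert H; apply filter_imp; intros x; rewrite E; trivial.
Qed.

Lemma cont_uniform_limit a (S : nat -> R -> C) s (c : nat -> R) :
  (forall n, cont a (S n)) ->
  (forall n x, half_open a x -> Cmod (s x - S n x)%C <= c n) ->
  (forall eps, 0 < eps -> exists n, c n <= eps) -> cont a s.
Proof.
intros HS Hc H0 x Hx eps Heps; destruct (H0 (eps / 3) ltac:(lra)) as [n Hn].
generalize (filter_and (F := near a x) _ _ (near_self a x) (HS n x Hx (eps / 3) ltac:(lra))).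
apply filter_imp; intros y [H1 H2].
assert (H3 := Hc n x Hx); assert (H4 := Hc n y H1).
replace (s y - s x)%C with ((s y - S n y) + ((S n y - S n x) + - (s x - S n x)))%C by ring.
eapply Rle_trans; [apply Cmod_triangle | ].
assert (H5 := Cmod_triangle (S n y - S n x)%C (- (s x - S n x))%C).
rewrite Cmod_opp in H5; lra.
Qed.

Notation is_seriesC := (@is_series R_AbsRing C_R_NormedModule).
Notation sum_nC := (@sum_n C_R_NormedModule).

Lemma sum_nC_S (u : nat -> C) n : sum_nC u (S n) = (sum_nC u n + u (S n))%C.
Proof. apply (@sum_Sn C_R_NormedModule). Qed.

(** The partial sums from [n] to [n + j] are compared first, then [j] tends to infinity. Keeping the
    factor [c] apart from [b] allows one majorant series to serve both components. *)
Lemma series_tail (u : nat -> C) l (b : nat -> R) (s : R) c n : 0 <= c ->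
  is_seriesC u l -> is_series b s -> (forall k, 0 <= b k) ->
  (forall k, Cmod (u k) <= c * b k) ->
  Cmod (l - sum_nC u n)%C <= c * (s - sum_n b n).
Proof.
intros Hc Hu Hb Hb0 Hub.
assert (Hp : forall j, Cmod (sum_nC u (n + j) - sum_nC u n)%C
  <= c * (sum_n b (n + j) - sum_n b n)).
{ induction j as [|j IH].
  - rewrite Nat.add_0_r; replace (sum_nC u n - sum_nC u n)%C with (RtoC 0) by ring.
    rewrite Cmod_0; lra.
  - rewrite Nat.add_succ_r, sum_nC_S, sum_Sn.
    replace (sum_nC u (n + j) + u (S (n + j)) - sum_nC u n)%C
      with ((sum_nC u (n + j) - sum_nC u n) + u (S (n + j)))%C by ring.
    eapply Rle_trans; [apply Cmod_triangle | ].
    assert (H := Hub (S (n + j))%nat).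
    change (plus (sum_n b (n + j)) (b (S (n + j)))) with (sum_n b (n + j) + b (S (n + j))).
    lra. }
assert (Hs : forall k, sum_n b k <= s).
{ intros k; apply (is_lim_seq_incr_compare (sum_n b) s Hb).
  intros j; rewrite sum_Sn; change (sum_n b j <= sum_n b j + b (S j)).
  generalize (Hb0 (S j)); lra. }
apply le_epsilon; intros eps Heps.
assert (HQ := proj1 (@filterlim_locally_ball_norm R_AbsRing nat C_R_NormedModule
  eventually (filter_filter (F := eventually)) (sum_nC u) l) Hu (mkposreal eps Heps)).
destruct HQ as [N0 HN0].
specialize (HN0 (n + N0)%nat ltac:(lia)); unfold ball_norm in HN0.
rewrite norm_Cmod in HN0; simpl in HN0.
change (Cmod (sum_nC u (n + N0) - l)%C < eps) in HN0.
replace (l - sum_nC u n)%C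
  with (- (sum_nC u (n + N0) - l) + (sum_nC u (n + N0) - sum_nC u n))%C by ring.
eapply Rle_trans; [apply Cmod_triangle | ].
rewrite Cmod_opp; specialize (Hp N0); specialize (Hs (n + N0)%nat).
assert (c * (sum_n b (n + N0) - sum_n b n) <= c * (s - sum_n b n))
  by (apply Rmult_le_compat_l; lra).
lra.
Qed.

(** [iota] returns the sum here because domination gives existence and limits are unique. *)
Lemma series_dominated (u : nat -> C) (b : nat -> R) :
  ex_series b -> (forall k, Cmod (u k) <= b k) ->
  is_seriesC u (@iota C_R_CompleteNormedModule (is_seriesC u)).
Proof.
intros Hb Hub; apply (@iota_correct R_AbsRing C_R_CompleteNormedModule (is_seriesC u)).
destruct (@ex_series_le R_AbsRing C_R_CompleteNormedModule u b) as [l Hl]; trivial.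
- intros n; eapply Rle_trans; [ | apply Hub]; apply Req_le, norm_Cmod.
- exists l; split; [exact Hl | ].
  intros l' Hl'; exact (@filterlim_locally_unique nat R_AbsRing C_R_NormedModule eventually
    _ (sum_nC u) l l' Hl Hl').
Qed.

Lemma is_series_exp y : is_series (fun n => / INR (fact n) * y ^ n) (exp y).
Proof.
apply (is_series_ext (fun n => scal (pow_n y n) (/ INR (fact n)))); [ | apply is_exp_Reals].
intros n; rewrite pow_n_pow; apply Rmult_comm.
Qed.

Lemma Cmod_arbitrarily_small z c (N : nat -> R) : 0 <= c ->
  (forall n, Cmod z <= c * N n) -> (forall eps, 0 < eps -> exists n, N n <= eps) ->
  z = 0%C.
Proof.
intros Hc H H0; apply Cmod_eq_0, Rle_antisym; [ | apply Cmod_ge_0].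
apply le_epsilon; intros eps Heps.
(* Dividing by [c + 1] rather than [c] covers the case [c = 0]. *)
destruct (H0 (eps / (c + 1))) as [n Hn]; [apply Rdiv_lt_0_compat; lra | ].
specialize (H n).
assert (c * N n <= c * (eps / (c + 1))) by (apply Rmult_le_compat_l; lra).
assert (c * (eps / (c + 1)) <= eps); [ | lra].
apply (Rmult_le_reg_r (c + 1)); [lra | ].
replace (c * (eps / (c + 1)) * (c + 1)) with (c * eps) by (field; lra); nra.
Qed.

(** * A priori bounds *)

Section Dirac.

Variables (a kappa : R) (p1 p2 q : R -> C) (cq alpha M : R).
Hypothesis a_gt0 : 0 < a.
Hypothesis kappa_ge : 1 / 2 <= kappa.
Hypothesis cont_p1 : cont a p1.
Hypothesis cont_p2 : cont a p2.
Hypothesis cont_q : cont a q.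
Hypothesis cq_gt0 : 0 < cq.
Hypothesis alpha_range : -1 < alpha <= 0.
Hypothesis q_bound : forall x, half_open a x -> Cmod (q x) <= cq * Rpower x alpha.
Hypothesis M_gt0 : 0 < M.
Hypothesis p1_bound : forall x, half_open a x -> Cmod (p1 x) <= M.
Hypothesis p2_bound : forall x, half_open a x -> Cmod (p2 x) <= M.

(** [e] and [ei] are the off-diagonal weights of the scaled system; [m], up to the factor
    [2 * kappa + 1] a primitive of [e], is the order of vanishing of the second component. *)
Let e x := Rpower x (2 * kappa).
Let ei x := Rpower x (- (2 * kappa)).
Let m x := Rpower x (2 * kappa + 1).
(* [K] is chosen so that [w' >= |q| + M * M * x] on (0, a], see [dw_ge]. *)
Let K := (cq + M * M * Rpower a (1 - alpha)) / (1 + alpha).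
Let w x := K * Rpower x (1 + alpha).
Let dw x := K * ((1 + alpha) * Rpower x alpha).

Lemma K_gt0 : 0 < K.
Proof.
apply Rdiv_lt_0_compat; [ | lra].
assert (H := Rpower_gt0 a (1 - alpha)); assert (0 < M * M) by nra; nra.
Qed.

Lemma w_gt0 x : 0 < w x.
Proof. apply Rmult_lt_0_compat; [apply K_gt0 | apply Rpower_gt0]. Qed.

Lemma is_derive_w x : 0 < x -> is_derive w x (dw x).
Proof.
intros Hx; unfold w, dw.
replace (Rpower x alpha) with (Rpower x (1 + alpha - 1)) by (f_equal; ring).
apply @is_derive_scal, is_derive_Rpower, Hx.
Qed.

Lemma dw_ge x : half_open a x -> cq * Rpower x alpha + M * M * x <= dw x.
Proof.
intros [Hx Hxa]; unfold dw, K.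
replace ((cq + M * M * Rpower a (1 - alpha)) / (1 + alpha) * ((1 + alpha) * Rpower x alpha))
  with (cq * Rpower x alpha + M * M * (Rpower a (1 - alpha) * Rpower x alpha))
  by (field; lra).
(* Write [x] as [x^(1 - alpha) x^alpha] and use [1 - alpha > 0]: this is the origin of the power of
   [a] in [K]. *)
assert (H : x <= Rpower a (1 - alpha) * Rpower x alpha).
{ rewrite <- (Rpower_1 x) at 1 by trivial.
  replace 1 with (1 - alpha + alpha) at 1 by ring; rewrite Rpower_plus.
  apply Rmult_le_compat_r; [apply Rlt_le, Rpower_gt0 | apply Rle_Rpower_l; lra]. }
assert (0 < M * M) by nra; nra.
Qed.

Lemma dw_ge_q x : half_open a x -> Cmod (q x) <= dw x.
Proof.
intros Hx; assert (H1 := dw_ge x Hx); assert (H2 := q_bound x Hx).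
destruct Hx as [Hx _]; assert (0 < M * M) by nra; nra.
Qed.

Lemma ei_e x : ei x * e x = 1.
Proof.
unfold ei, e; rewrite <- Rpower_plus.
replace (- (2 * kappa) + 2 * kappa) with 0 by ring; unfold Rpower.
rewrite Rmult_0_l; apply exp_0.
Qed.

Lemma m_e x : 0 < x -> m x = e x * x.
Proof. intros Hx; unfold m, e; rewrite Rpower_plus, (Rpower_1 x) by trivial; reflexivity. Qed.

Lemma is_derive_m x : 0 < x -> is_derive m x ((2 * kappa + 1) * e x).
Proof.
intros Hx; unfold m, e.
replace (Rpower x (2 * kappa)) with (Rpower x (2 * kappa + 1 - 1)) by (f_equal; ring).
apply is_derive_Rpower, Hx.
Qed.

Notation dA := (dA kappa p2 q).
Notation dB := (dB kappa p1 q).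

(* If [|A| <= N w^n] and [|B| <= M m N w^n], then [dhA] and [dhB] dominate the
   right-hand sides of the scaled system; [hA] and [hB] are their primitives. *)
Definition hA N n x := N / INR (S n) * w x ^ S n.
Definition dhA N n x := N * w x ^ n * dw x.
Definition hB N n x := M * (m x * hA N n x).
Definition dhB N n x := M * ((2 * kappa + 1) * e x * hA N n x + m x * dhA N n x).

Lemma is_derive_hA N n x : 0 < x -> is_derive (hA N n) x (dhA N n x).
Proof.
intros Hx; unfold hA, dhA.
replace (N * w x ^ n * dw x) with (N / INR (S n) * (INR (S n) * dw x * w x ^ pred (S n))).
- apply @is_derive_scal, is_derive_pow, is_derive_w, Hx.
- change (pred (S n)) with n; field; apply not_0_INR; lia.
Qed.

Lemma is_derive_hB N n x : 0 < x -> is_derive (hB N n) x (dhB N n x).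
Proof.
intros Hx; unfold hB, dhB; apply @is_derive_scal.
apply (is_derive_mult m (hA N n)); [apply is_derive_m | apply is_derive_hA | apply Rmult_comm]; trivial.
Qed.

Lemma hA_ge0 N n x : 0 <= N -> 0 <= hA N n x.
Proof.
intros HN; apply Rmult_le_pos; [ | apply pow_le, Rlt_le, w_gt0].
apply Rdiv_le_0_compat; [trivial | apply lt_0_INR; lia].
Qed.

Lemma m_gt0 x : 0 < m x.
Proof. apply Rpower_gt0. Qed.

Lemma m_le x : half_open a x -> m x <= m a.
Proof. intros Hx; apply Rle_Rpower_l; unfold half_open in Hx; lra. Qed.

Lemma hB_ge0 N n x : 0 <= N -> 0 <= hB N n x.
Proof.
intros HN; apply Rmult_le_pos; [lra | apply Rmult_le_pos; [ | apply hA_ge0, HN]].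
apply Rlt_le, m_gt0.
Qed.

Lemma w_vanishes : vanishes (fun x => RtoC (w x)).
Proof.
unfold w; replace (RtoC 0) with (RtoC K * 0)%C by ring.
eapply (tends_ext (at_right 0) (fun x => RtoC K * RtoC (Rpower x (1 + alpha)))%C).
- apply filter_forall; intros x; rewrite RtoC_mult; reflexivity.
- apply (tends_mult (at_right 0)); [apply (tends_const (at_right 0)) | ].
  apply Rpower_vanishes; lra.
Qed.

Lemma m_vanishes : vanishes (fun x => RtoC (m x)).
Proof. apply Rpower_vanishes; lra. Qed.

Lemma hA_vanishes N n : vanishes (fun x => RtoC (hA N n x)).
Proof.
assert (H : vanishes (fun x => RtoC (w x ^ S n))).
{ induction n as [|n IH].
  - eapply (tends_ext (at_right 0)); [ | apply w_vanishes].
    apply filter_forall; intros x; simpl; rewrite Rmult_1_r; reflexivity.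
  - replace (RtoC 0) with (0 * 0)%C by ring.
    eapply (tends_ext (at_right 0)); [ | apply (tends_mult (at_right 0)); [apply w_vanishes | apply IH]].
    apply filter_forall; intros x; rewrite <- RtoC_mult; reflexivity. }
replace (RtoC 0) with (RtoC (N / INR (S n)) * 0)%C by ring.
eapply (tends_ext (at_right 0));
  [ | apply (tends_mult (at_right 0)); [apply (tends_const (at_right 0)) | apply H]].
apply filter_forall; intros x; unfold hA; rewrite <- RtoC_mult; reflexivity.
Qed.

Lemma hB_vanishes N n : vanishes (fun x => RtoC (hB N n x)).
Proof.
replace (RtoC 0) with (RtoC M * (0 * 0))%C by ring.
eapply (tends_ext (at_right 0)); [ | apply (tends_mult (at_right 0));
  [apply (tends_const (at_right 0)) | apply (tends_mult (at_right 0));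
    [apply m_vanishes | apply (hA_vanishes N n)]]].
apply filter_forall; intros x; unfold hB; rewrite <- !RtoC_mult; reflexivity.
Qed.

(** Since [ei * m = x], the weight in the bound on [B] cancels the singular coefficient. The
    right-hand side is then at most [(cq x^alpha + M M x) N w^n], and [dw_ge] applies. *)
Lemma dA_bound N n A B x : half_open a x -> 0 <= N ->
  Cmod (A x) <= N * w x ^ n -> Cmod (B x) <= M * (m x * (N * w x ^ n)) ->
  Cmod (dA A B x) <= dhA N n x.
Proof.
intros Hx HN HA HB; unfold dA, dhA; fold (ei x); set (t := N * w x ^ n) in *.
assert (Ht : 0 <= t) by (apply Rmult_le_pos; [trivial | apply pow_le, Rlt_le, w_gt0]).
eapply Rle_trans; [apply Cmod_triangle | ].
rewrite !Cmod_mult, Cmod_R, Rabs_pos_eq by apply Rlt_le, Rpower_gt0.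
assert (H1 : Cmod (q x) * Cmod (A x) <= cq * Rpower x alpha * t).
{ apply Rmult_le_compat; try apply Cmod_ge_0; auto. }
assert (H2 : ei x * Cmod (p2 x) * Cmod (B x) <= ei x * M * (M * (m x * t))).
{ assert (0 < ei x) by apply Rpower_gt0.
  apply Rmult_le_compat; try apply Cmod_ge_0; trivial.
  - apply Rmult_le_pos; [lra | apply Cmod_ge_0].
  - apply Rmult_le_compat_l; [lra | auto]. }
replace (ei x * M * (M * (m x * t))) with ((M * M * x) * t) in H2.
- assert (H3 := dw_ge x Hx); nra.
- rewrite (m_e x (proj1 Hx)).
  transitivity (M * M * x * t * (ei x * e x)); [rewrite ei_e | ]; ring.
Qed.

(** [A] is assumed to satisfy the improved bound [hA], [B] still the old one. The two terms of the
    derivative of [m * hA] take one each: [(2 kappa + 1) e hA] dominates [e p1 A], and [m dhA]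
    dominates [q B]. *)
Lemma dB_bound N n A B x : half_open a x -> 0 <= N ->
  Cmod (A x) <= hA N n x -> Cmod (B x) <= M * (m x * (N * w x ^ n)) ->
  Cmod (dB A B x) <= dhB N n x.
Proof.
intros Hx HN HA HB; unfold dB, dhB, dhA; fold (e x); rewrite Cmod_opp; set (t := N * w x ^ n) in *.
assert (Ht : 0 <= t) by (apply Rmult_le_pos; [trivial | apply pow_le, Rlt_le, w_gt0]).
eapply Rle_trans; [apply Cmod_triangle | ].
assert (He : 0 < e x) by apply Rpower_gt0; assert (Hm := m_gt0 x).
assert (HhA := hA_ge0 N n x HN).
rewrite !Cmod_mult, Cmod_R, Rabs_pos_eq by (apply Rlt_le; trivial).
assert (H1 : Cmod (q x) * Cmod (B x) <= dw x * (M * (m x * t))).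
{ apply Rmult_le_compat; try apply Cmod_ge_0; [apply dw_ge_q | ]; trivial. }
assert (H2 : e x * Cmod (p1 x) * Cmod (A x) <= e x * M * hA N n x).
{ apply Rmult_le_compat; try apply Cmod_ge_0; trivial.
  - apply Rmult_le_pos; [lra | apply Cmod_ge_0].
  - apply Rmult_le_compat_l; [lra | auto]. }
assert (H3 : e x * M * hA N n x <= M * ((2 * kappa + 1) * e x * hA N n x)).
{ assert (0 <= M * e x * hA N n x) by (apply Rmult_le_pos; [nra | trivial]); nra. }
nra.
Qed.

Lemma cont_dA A B : cont a A -> cont a B -> cont a (dA A B).
Proof.
intros HA HB; apply cont_plus; apply cont_mult; auto.
apply cont_mult; auto.
apply cont_RtoC; intros; apply continuous_Rpower; trivial.
Qed.

Lemma cont_dB A B : cont a A -> cont a B -> cont a (dB A B).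
Proof.
intros HA HB; apply cont_opp, cont_plus; apply cont_mult; auto.
apply cont_mult; auto.
apply cont_RtoC; intros; apply continuous_Rpower; trivial.
Qed.

(** This is [f0 * g0], the scaled second component of the unperturbed solution, and hence the
    starting iterate [B_0]. *)
Definition G x : C := (- int0 (fun t => RtoC (Rpower t (2 * kappa)) * p1 t) x)%C.

(** The derivative [M (2 kappa + 1) e] of the majorant [M * m] dominates [e |p1|], as
    [2 kappa + 1 >= 1]. It yields both the convergence of the integral and the bound. *)
Lemma G_spec :
  (forall x, half_open a x -> der a G x (- (RtoC (e x) * p1 x))%C) /\ vanishes G /\
  (forall x, half_open a x -> Cmod (G x) <= M * m x).
Proof.
set (f := fun t => (RtoC (e t) * p1 t)%C).
assert (Hf : cont a f).
{ apply cont_mult; auto; apply cont_RtoC; intros; apply continuous_Rpower; trivial. }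
assert (Hh : forall x, half_open a x -> is_derive (fun t => M * m t) x (M * ((2 * kappa + 1) * e x))).
{ intros x Hx; apply @is_derive_scal, is_derive_m, Hx. }
assert (Hb : forall x, half_open a x -> Cmod (f x) <= M * ((2 * kappa + 1) * e x)).
{ intros x Hx; assert (0 < e x) by apply Rpower_gt0; unfold f.
  rewrite Cmod_Rmult by lra; assert (H1 := p1_bound x Hx).
  assert (e x * Cmod (p1 x) <= e x * M) by (apply Rmult_le_compat_l; lra).
  assert (0 <= M * e x) by nra; nra. }
destruct (primitive_exists a f _ _ a_gt0 Hf Hh Hb) as [F [HF HF0]].
{ replace (RtoC 0) with (RtoC M * 0)%C by ring.
  eapply (tends_ext (at_right 0)); [ | apply (tends_mult (at_right 0));
    [apply (tends_const (at_right 0)) | apply m_vanishes]].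
  apply filter_forall; intros x; rewrite RtoC_mult; reflexivity. }
assert (E : forall x, half_open a x -> (- F x)%C = G x).
{ intros x Hx; unfold G; f_equal; symmetry; apply (int0_primitive a F f); trivial. }
repeat split.
- intros x Hx; apply (der_ext a (fun x => - F x)%C); trivial; apply der_opp; auto.
- replace (RtoC 0) with (- 0)%C by ring.
  apply (tends_ext (at_right 0) (fun x => - F x)%C).
  + generalize (at_right_below a a_gt0); apply filter_imp; intros y Hy.
    apply E; unfold half_open; lra.
  + apply (tends_opp (at_right 0)); trivial.
- intros x Hx; rewrite <- E, Cmod_opp by trivial.
  apply (der_bound a F f (fun t => M * m t) (fun x => M * ((2 * kappa + 1) * e x))); trivial.
  intros t Ht; assert (H1 := m_gt0 t); nra.
Qed.

(** * Recursive integrals *)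

Let f := f0 kappa.
Let g := g0 kappa p1.

Lemma f_neq0 x : f x <> 0%C.
Proof.
intros E; assert (H := Rpower_gt0 x kappa); apply (f_equal fst) in E.
simpl in E; lra.
Qed.

Lemma f_g x : (f x * g x)%C = G x.
Proof.
unfold f, g, f0, g0, G.
replace (RtoC (Rpower x kappa) * (- RtoC (Rpower x (- kappa))
  * int0 (fun t => (RtoC (Rpower t (2 * kappa)) * p1 t)%C) x))%C
  with (- (RtoC (Rpower x kappa) * RtoC (Rpower x (- kappa)))
  * int0 (fun t => (RtoC (Rpower t (2 * kappa)) * p1 t)%C) x)%C by ring.
rewrite <- RtoC_mult, <- Rpower_plus, Rplus_opp_r.
unfold Rpower at 1; rewrite Rmult_0_l, exp_0; ring.
Qed.

Lemma f_f_ei x : (f x * f x * RtoC (ei x))%C = 1%C.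
Proof.
unfold f, f0, ei; rewrite <- !RtoC_mult, <- !Rpower_plus.
replace (kappa + kappa + - (2 * kappa)) with 0 by ring.
unfold Rpower; rewrite Rmult_0_l, exp_0; reflexivity.
Qed.

Lemma ei_f x : RtoC (ei x) = (/ (f x * f x))%C.
Proof.
assert (H := f_neq0 x); transitivity (f x * f x * RtoC (ei x) / (f x * f x))%C.
- field; trivial.
- rewrite f_f_ei; field; trivial.
Qed.

Lemma fact_neq0C n : RtoC (INR (fact n)) <> 0%C.
Proof. intros E; apply (INR_fact_neq_0 n); exact (f_equal fst E). Qed.

Lemma factS n : RtoC (INR (fact (S n))) = (RtoC (INR (S n)) * RtoC (INR (fact n)))%C.
Proof. rewrite fact_simpl, mult_INR, RtoC_mult; reflexivity. Qed.

Lemma INRS_neq0C n : RtoC (INR (S n)) <> 0%C.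
Proof. intros E; apply (not_0_INR (S n)); [lia | exact (f_equal fst E)]. Qed.

Ltac nz := repeat split; first [apply INRS_neq0C | apply fact_neq0C | apply f_neq0].

Let X := Xhat f g p2 q.
Let Y := Yhat f g p2 q.

Lemma X_S n x : X (S n) x = Xstep f p2 q n (X n) (Y n) x.
Proof. unfold X, Y, Xhat, Yhat; simpl; destruct (XYhat f g p2 q n); reflexivity. Qed.

Lemma Y_S n x : Y (S n) x = Ystep f g p2 q n (X n) (Y n) x.
Proof. unfold X, Y, Xhat, Yhat; simpl; destruct (XYhat f g p2 q n); reflexivity. Qed.

Definition An n x : C := (X n x / (RtoC (INR (fact n)) * f x))%C.
Definition Bn n x : C := (f x * Y n x / RtoC (INR (fact n)))%C.

Lemma X_An n x : X n x = (RtoC (INR (fact n)) * f x * An n x)%C.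
Proof. unfold An; field; nz. Qed.

Lemma Y_Bn n x : Y n x = (RtoC (INR (fact n)) * Bn n x / f x)%C.
Proof. unfold Bn; field; nz. Qed.

(** Invariant of the induction on [n]: continuity makes the next integrands integrable away from
    [0], the bounds make them integrable at [0]. *)
Definition step_ok n :=
  cont a (An n) /\ cont a (Bn n) /\
  forall x, half_open a x ->
    Cmod (An n x) <= / INR (fact n) * w x ^ n /\
    Cmod (Bn n x) <= M * (m x * (/ INR (fact n) * w x ^ n)).

Lemma inv_fact_gt0 n : 0 < / INR (fact n).
Proof. apply Rinv_0_lt_compat, INR_fact_lt_0. Qed.

(** The integrand of [Xstep] is [n!] times [dA (An n) (Bn n)], so [dA_bound] provides the primitive
    that evaluates it; the prefactor [n + 1] completes [n!] to the factorial by which [An (S n)] is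
    divided. *)
Lemma An_S n : step_ok n ->
  (forall x, half_open a x -> der a (An (S n)) x (dA (An n) (Bn n) x)) /\
  vanishes (An (S n)).
Proof.
intros [HA [HB Hb]].
assert (Hc := cont_dA _ _ HA HB).
destruct (primitive_exists a (dA (An n) (Bn n)) (hA (/ INR (fact n)) n) (dhA (/ INR (fact n)) n))
  as [F [HF HF0]]; trivial.
- intros x Hx; apply is_derive_hA, Hx.
- intros x Hx; apply dA_bound; trivial; [apply Rlt_le, inv_fact_gt0 | apply Hb, Hx | apply Hb, Hx].
- apply hA_vanishes.
- assert (E : forall x, half_open a x -> F x = An (S n) x).
  { intros x Hx; unfold An; rewrite X_S; unfold Xstep.
    set (i := fun t => (RtoC (INR (fact n)) * dA (An n) (Bn n) t)%C).
    assert (Ei : forall t, i t = (q t / f t * X n t + p2 t / f t * Y n t)%C).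
    { intros t; unfold i, dA; fold (ei t); rewrite X_An, Y_Bn, ei_f; field; apply f_neq0. }
    rewrite (int0_primitive a (fun t => RtoC (INR (fact n)) * F t)%C); trivial.
    - rewrite factS; field; nz.
    - intros t Ht; rewrite <- Ei; unfold i.
      replace (RtoC (INR (fact n)) * dA (An n) (Bn n) t)%C
        with (0 * F t + RtoC (INR (fact n)) * dA (An n) (Bn n) t)%C by ring.
      apply (der_mult a (fun _ => RtoC (INR (fact n)))); [apply der_const | auto].
    - apply (cont_ext a i); [intros t _; apply Ei | ].
      apply cont_mult; [apply cont_const | trivial].
    - replace (RtoC 0) with (RtoC (INR (fact n)) * 0)%C by ring.
      apply (tends_mult (at_right 0)); [apply (tends_const (at_right 0)) | trivial]. }
  split.
  + intros x Hx; apply (der_ext a F); auto.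
  + apply (tends_ext (at_right 0) F); trivial.
    generalize (at_right_below a a_gt0); apply filter_imp; intros y Hy.
    apply E; unfold half_open; lra.
Qed.

(* The integrand of [Zstep] is a multiple of [- (G dA + q B)], and
   [G An (S n)] has derivative [- e p1 An (S n) + G dA]: the sum telescopes to [dB]. *)
Lemma Bn_S n : step_ok n ->
  (forall x, half_open a x -> der a (Bn (S n)) x (dB (An (S n)) (Bn n) x)) /\
  vanishes (Bn (S n)).
Proof.
intros Hok; destruct (An_S n Hok) as [HdA HA0]; destruct Hok as [HA [HB Hb]].
destruct G_spec as [HdG [HG0 HGb]].
set (N := / INR (fact n)) in *.
assert (HN : 0 < N) by apply inv_fact_gt0.
set (z := fun t => (- (G t * dA (An n) (Bn n) t + q t * Bn n t))%C).
assert (Hc : cont a z).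
{ apply cont_opp, cont_plus; apply cont_mult; trivial.
  - apply (der_cont _ _ _ HdG).
  - apply cont_dA; trivial. }
assert (Hma := m_gt0 a).
(* [G dA] and [q B] are each at most [M m(a) dhA], whence the factor 2. This crude majorant only
   secures a primitive; the sharp bound on [Bn (S n)] comes later from its derivative. *)
destruct (primitive_exists a z (fun x => 2 * M * m a * hA N n x)
  (fun x => 2 * M * m a * dhA N n x)) as [F [HF HF0]]; trivial.
- intros x Hx; apply @is_derive_scal, is_derive_hA, Hx.
- intros x Hx; destruct (Hb x Hx) as [HbA HbB].
  assert (HbdA := dA_bound N n _ _ x Hx (Rlt_le _ _ HN) HbA HbB).
  unfold z; rewrite Cmod_opp; eapply Rle_trans; [apply Cmod_triangle | ].
  assert (Hmx := m_le x Hx); assert (Hmx0 := m_gt0 x).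
  assert (H1 : Cmod (G x * dA (An n) (Bn n) x)%C <= M * m a * dhA N n x).
  { rewrite Cmod_mult; apply Rmult_le_compat; try apply Cmod_ge_0; trivial.
    eapply Rle_trans; [apply HGb, Hx | nra]. }
  assert (H2 : Cmod (q x * Bn n x)%C <= dw x * (M * (m a * (N * w x ^ n)))).
  { rewrite Cmod_mult; apply Rmult_le_compat; try apply Cmod_ge_0; [apply dw_ge_q, Hx | ].
    eapply Rle_trans; [exact HbB | apply Rmult_le_compat_l; [lra | ]].
    apply Rmult_le_compat_r; [ | trivial].
    apply Rmult_le_pos; [lra | apply pow_le, Rlt_le, w_gt0]. }
  replace (dw x * (M * (m a * (N * w x ^ n)))) with (M * m a * dhA N n x) in H2
    by (unfold dhA; ring).
  lra.
- replace (RtoC 0) with (RtoC (2 * M * m a) * 0)%C by ring.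
  eapply (tends_ext (at_right 0)); [ | apply (tends_mult (at_right 0));
    [apply (tends_const (at_right 0)) | apply (hA_vanishes N n)]].
  apply filter_forall; intros x; rewrite <- !RtoC_mult; reflexivity.
(* After scaling, the [Zstep] term of [Ystep] becomes [F], and the term with [g / f] becomes
   [G * An (S n)]. *)
- assert (E : forall x, half_open a x -> (F x + G x * An (S n) x)%C = Bn (S n) x).
  { intros x Hx; unfold Bn; rewrite Y_S; unfold Ystep, Zstep.
    rewrite <- X_S, X_An, <- f_g.
    set (i := fun t => (RtoC (INR (fact n)) * z t)%C).
    assert (Ei : forall t, i t = (- X n t * g t * q t + Y n t * (- f t * q t - g t * p2 t))%C).
    { intros t; unfold i, z, dA; fold (ei t); rewrite X_An, Y_Bn, ei_f, <- f_g; field; apply f_neq0. }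
    rewrite (int0_primitive a (fun t => RtoC (INR (fact n)) * F t)%C); trivial.
    - rewrite factS; field; nz.
    - intros t Ht; rewrite <- Ei; unfold i.
      replace (RtoC (INR (fact n)) * z t)%C
        with (0 * F t + RtoC (INR (fact n)) * z t)%C by ring.
      apply (der_mult a (fun _ => RtoC (INR (fact n)))); [apply der_const | auto].
    - apply (cont_ext a i); [intros t _; apply Ei | ].
      apply cont_mult; [apply cont_const | trivial].
    - replace (RtoC 0) with (RtoC (INR (fact n)) * 0)%C by ring.
      apply (tends_mult (at_right 0)); [apply (tends_const (at_right 0)) | trivial]. }
  split.
  + intros x Hx; apply (der_ext a (fun x => F x + G x * An (S n) x)%C); auto.
    replace (dB (An (S n)) (Bn n) x) with
      (z x + (- (RtoC (e x) * p1 x) * An (S n) x + G x * dA (An n) (Bn n) x))%C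
      by (unfold z, dB; fold (e x); ring).
    apply der_plus; [auto | apply der_mult; auto].
  + apply (tends_ext (at_right 0) (fun x => F x + G x * An (S n) x)%C); trivial.
    * generalize (at_right_below a a_gt0); apply filter_imp; intros y Hy.
      apply E; unfold half_open; lra.
    * replace (RtoC 0) with (0 + 0 * 0)%C by ring.
      apply (tends_plus (at_right 0)); [trivial | apply (tends_mult (at_right 0)); trivial].
Qed.

Lemma hA_fact n x : hA (/ INR (fact n)) n x = / INR (fact (S n)) * w x ^ S n.
Proof.
unfold hA; rewrite fact_simpl, mult_INR; field; split; [apply INR_fact_neq_0 | apply not_0_INR; lia].
Qed.

Lemma An_0 x : An 0 x = 1%C.
Proof.
unfold An; change (X 0 x) with (f x); simpl fact; simpl INR; field; apply f_neq0.
Qed.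

Lemma Bn_0 x : Bn 0 x = G x.
Proof. unfold Bn; change (Y 0 x) with (g x); rewrite <- f_g; simpl fact; simpl INR; field. Qed.

(** The comparison principle turns the derivatives of the new iterates into factorial bounds.
    [An (S n)] goes first, because [dB_bound] consumes its new bound. *)
Lemma steps_ok n : step_ok n.
Proof.
induction n as [|n IH].
- destruct G_spec as [HdG [HG0 HGb]].
  split; [ | split].
  + apply (cont_ext a (fun _ => 1%C)); [intros; rewrite An_0; trivial | apply cont_const].
  + apply (cont_ext a G); [intros; rewrite Bn_0; trivial | apply (der_cont _ _ _ HdG)].
  + intros x Hx; rewrite An_0, Bn_0; simpl; rewrite Cmod_1; split; [lra | ].
    replace (M * (m x * (/ 1 * 1))) with (M * m x) by field; auto.
- destruct (An_S n IH) as [HdA HA0]; destruct (Bn_S n IH) as [HdB HB0].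
  destruct IH as [HA [HB Hb]]; assert (HN := Rlt_le _ _ (inv_fact_gt0 n)).
  assert (HbA : forall x, half_open a x -> Cmod (An (S n) x) <= hA (/ INR (fact n)) n x).
  { apply (der_bound a _ _ (hA (/ INR (fact n)) n) (dhA (/ INR (fact n)) n) HdA); trivial.
    - intros t Ht; apply is_derive_hA, Ht.
    - intros t Ht; apply dA_bound; trivial; apply Hb, Ht.
    - intros t Ht; apply hA_ge0; trivial. }
  split; [apply (der_cont _ _ _ HdA) | split; [apply (der_cont _ _ _ HdB) | ]].
  intros x Hx; rewrite <- hA_fact; split; [auto | ].
  apply (der_bound a _ _ (hB (/ INR (fact n)) n) (dhB (/ INR (fact n)) n) HdB); trivial.
  + intros t Ht; apply is_derive_hB, Ht.
  + intros t Ht; apply dB_bound; auto; apply Hb, Ht.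
  + intros t Ht; apply hB_ge0; trivial.
Qed.

(** * Sum of the series *)

(** Since [w] is increasing, the terms of the series of [exp (w a)] dominate all iterates uniformly
    on (0, a]; [tail] is the remainder of that series. *)
Let b n := / INR (fact n) * w a ^ n.
Let E := exp (w a).
Let tail n := E - sum_n b n.

Lemma w_le x : half_open a x -> w x <= w a.
Proof.
intros Hx; apply Rmult_le_compat_l; [apply Rlt_le, K_gt0 | ].
apply Rle_Rpower_l; unfold half_open in Hx; lra.
Qed.

Lemma b_ge0 n : 0 <= b n.
Proof.
apply Rmult_le_pos; [apply Rlt_le, inv_fact_gt0 | apply pow_le, Rlt_le, w_gt0].
Qed.

Lemma b_series : is_series b E.
Proof. apply is_series_exp. Qed.

Lemma w_pow_le_b n x : half_open a x -> / INR (fact n) * w x ^ n <= b n.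
Proof.
intros Hx; apply Rmult_le_compat_l; [apply Rlt_le, inv_fact_gt0 | ].
apply pow_incr; split; [apply Rlt_le, w_gt0 | apply w_le, Hx].
Qed.

(** The factor [1] matches the shape [c * b k] expected by [series_tail]. *)
Lemma An_le n x : half_open a x -> Cmod (An n x) <= 1 * b n.
Proof.
intros Hx; destruct (steps_ok n) as [_ [_ H]]; destruct (H x Hx) as [H1 _].
assert (H2 := w_pow_le_b n x Hx); lra.
Qed.

Lemma Bn_le n x : half_open a x -> Cmod (Bn n x) <= M * m x * b n.
Proof.
intros Hx; destruct (steps_ok n) as [_ [_ H]]; destruct (H x Hx) as [_ H1].
rewrite <- Rmult_assoc in H1; eapply Rle_trans; [exact H1 | ].
apply Rmult_le_compat_l; [ | apply w_pow_le_b, Hx].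
assert (H2 := m_gt0 x); nra.
Qed.

Definition As x : C :=
  @iota C_R_CompleteNormedModule (is_seriesC (fun n => An n x)).
Definition Bs x : C :=
  @iota C_R_CompleteNormedModule (is_seriesC (fun n => Bn n x)).
Definition SA n x : C := sum_nC (fun k => An k x) n.
Definition SB n x : C := sum_nC (fun k => Bn k x) n.

Lemma As_series x : half_open a x -> is_seriesC (fun n => An n x) (As x).
Proof.
intros Hx; apply (series_dominated _ (fun n => 1 * b n)); [ | intros; apply An_le, Hx].
apply @ex_series_scal_l; eexists; apply b_series.
Qed.

Lemma Bs_series x : half_open a x -> is_seriesC (fun n => Bn n x) (Bs x).
Proof.
intros Hx; apply (series_dominated _ (fun n => M * m x * b n)); [ | intros; apply Bn_le, Hx].
apply @ex_series_scal_l; eexists; apply b_series.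
Qed.

Lemma As_tail n x : half_open a x -> Cmod (As x - SA n x)%C <= tail n.
Proof.
intros Hx; rewrite <- (Rmult_1_l (tail n)); apply series_tail.
- lra.
- apply As_series, Hx.
- apply b_series.
- apply b_ge0.
- intros; apply An_le, Hx.
Qed.

Lemma Bs_tail n x : half_open a x -> Cmod (Bs x - SB n x)%C <= M * m x * tail n.
Proof.
intros Hx; apply series_tail.
- assert (H2 := m_gt0 x); nra.
- apply Bs_series, Hx.
- apply b_series.
- apply b_ge0.
- intros; apply Bn_le, Hx.
Qed.

Lemma tail_small eps : 0 < eps -> exists n, tail n <= eps.
Proof.
intros Heps.
destruct (proj1 (filterlim_locally (sum_n b) E) b_series (mkposreal eps Heps)) as [n Hn].
exists n; specialize (Hn n (le_n n)).
assert (H : Rabs (sum_n b n - E) < eps) by exact Hn.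
apply Rabs_def2 in H; unfold tail; lra.
Qed.

Lemma tail_S n : tail (S n) <= tail n.
Proof.
unfold tail; rewrite sum_Sn; change (plus (sum_n b n) (b (S n))) with (sum_n b n + b (S n)).
generalize (b_ge0 (S n)); lra.
Qed.

Lemma tail_ge0 n : 0 <= tail n.
Proof.
eapply Rle_trans; [apply Cmod_ge_0 | ].
apply (As_tail n a); unfold half_open; lra.
Qed.

(** The remainder after the zeroth term is at most [E - b 0], and the zeroth term at most [b 0]. *)
Lemma As_le x : half_open a x -> Cmod (As x) <= E.
Proof.
intros Hx; assert (H := As_tail 0 x Hx); assert (H1 := An_le 0 x Hx).
unfold tail, SA in H; rewrite !sum_O in H.
replace (As x) with ((As x - An 0 x) + An 0 x)%C by ring.
eapply Rle_trans; [apply Cmod_triangle | lra].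
Qed.

Lemma Bs_le x : half_open a x -> Cmod (Bs x) <= M * m x * E.
Proof.
intros Hx; assert (H := Bs_tail 0 x Hx); assert (H1 := Bn_le 0 x Hx).
unfold tail, SB in H; rewrite !sum_O in H.
replace (Bs x) with ((Bs x - Bn 0 x) + Bn 0 x)%C by ring.
eapply Rle_trans; [apply Cmod_triangle | lra].
Qed.

Lemma SA_S n x : SA (S n) x = (SA n x + An (S n) x)%C.
Proof. apply sum_nC_S. Qed.

Lemma SB_S n x : SB (S n) x = (SB n x + Bn (S n) x)%C.
Proof. apply sum_nC_S. Qed.

Lemma SA_0 x : SA 0 x = 1%C.
Proof. unfold SA; rewrite sum_O; apply An_0. Qed.

Lemma SB_0 x : SB 0 x = G x.
Proof. unfold SB; rewrite sum_O; apply Bn_0. Qed.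

(** Summing the recursion by linearity. The constant [A_0 = 1] contributes no derivative, and that
    of [B_0 = G] is exactly the term [- e p1 A_0] missing from the sum, so consecutive partial sums
    again form Picard iterates. *)
Lemma partial_sums n :
  (forall x, half_open a x ->
    der a (SA (S n)) x (dA (SA n) (SB n) x) /\ der a (SB (S n)) x (dB (SA (S n)) (SB n) x)) /\
  vanishes (fun x => SA (S n) x - 1)%C /\ vanishes (SB (S n)).
Proof.
induction n as [|n [IHd [IHA IHB]]].
- destruct (An_S 0 (steps_ok 0)) as [HA HA0]; destruct (Bn_S 0 (steps_ok 0)) as [HB HB0].
  destruct G_spec as [HG [HG0 _]].
  assert (EA : forall x, (1 + An 1 x)%C = SA 1 x) by (intros x; rewrite SA_S, SA_0; trivial).
  assert (EB : forall x, (G x + Bn 1 x)%C = SB 1 x) by (intros x; rewrite SB_S, SB_0; trivial).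
  repeat split.
  + apply (der_ext a (fun x => 1 + An 1 x)%C); auto.
    replace (dA (SA 0) (SB 0) x) with (0 + dA (An 0) (Bn 0) x)%C
      by (unfold dA; rewrite SA_0, SB_0, An_0, Bn_0; ring).
    apply der_plus; [apply der_const | auto].
  + apply (der_ext a (fun x => G x + Bn 1 x)%C); auto.
    replace (dB (SA 1) (SB 0) x) with (- (RtoC (e x) * p1 x) + dB (An 1) (Bn 0) x)%C
      by (unfold dB; fold (e x); rewrite <- EA, SB_0, Bn_0; ring).
    apply der_plus; auto.
  + apply (tends_ext (at_right 0) (An 1)); trivial.
    apply filter_forall; intros x; rewrite <- EA; ring.
  + apply (tends_ext (at_right 0) (fun x => G x + Bn 1 x)%C); trivial.
    * apply filter_forall; trivial.
    * replace (RtoC 0) with (0 + 0)%C by ring; apply (tends_plus (at_right 0)); trivial.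
- destruct (An_S (S n) (steps_ok (S n))) as [HA HA0].
  destruct (Bn_S (S n) (steps_ok (S n))) as [HB HB0].
  repeat split.
  + apply (der_ext a (fun x => SA (S n) x + An (S (S n)) x)%C); trivial.
    * intros y _; symmetry; apply SA_S.
    * replace (dA (SA (S n)) (SB (S n)) x)
        with (dA (SA n) (SB n) x + dA (An (S n)) (Bn (S n)) x)%C
        by (unfold dA; rewrite SA_S, SB_S; ring).
      apply der_plus; [apply IHd | apply HA]; trivial.
  + apply (der_ext a (fun x => SB (S n) x + Bn (S (S n)) x)%C); trivial.
    * intros y _; symmetry; apply SB_S.
    * replace (dB (SA (S (S n))) (SB (S n)) x)
        with (dB (SA (S n)) (SB n) x + dB (An (S (S n))) (Bn (S n)) x)%C
        by (unfold dB; rewrite (SA_S (S n)), (SB_S n); ring).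
      apply der_plus; [apply IHd | apply HB]; trivial.
  + apply (tends_ext (at_right 0) (fun x => (SA (S n) x - 1) + An (S (S n)) x)%C).
    * apply filter_forall; intros x; rewrite (SA_S (S n)); ring.
    * replace (RtoC 0) with (0 + 0)%C by ring; apply (tends_plus (at_right 0)); trivial.
  + apply (tends_ext (at_right 0) (fun x => SB (S n) x + Bn (S (S n)) x)%C).
    * apply filter_forall; intros x; rewrite (SB_S (S n)); ring.
    * replace (RtoC 0) with (0 + 0)%C by ring; apply (tends_plus (at_right 0)); trivial.
Qed.

Lemma SA_cont n : cont a (SA n).
Proof.
destruct n as [|n].
- apply (cont_ext a (fun _ => 1%C)); [intros; rewrite SA_0; trivial | apply cont_const].
- apply (der_cont _ _ (dA (SA n) (SB n))).
  intros x Hx; exact (proj1 (proj1 (partial_sums n) x Hx)).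
Qed.

Lemma SB_cont n : cont a (SB n).
Proof.
destruct n as [|n].
- apply (cont_ext a G); [intros; rewrite SB_0; trivial | ].
  exact (der_cont _ _ _ (proj1 G_spec)).
- apply (der_cont _ _ (dB (SA (S n)) (SB n))).
  intros x Hx; exact (proj2 (proj1 (partial_sums n) x Hx)).
Qed.

Lemma As_cont : cont a As.
Proof.
apply (cont_uniform_limit a SA As tail); [apply SA_cont | apply As_tail | apply tail_small].
Qed.

Lemma Bs_cont : cont a Bs.
Proof.
assert (Hma := m_gt0 a); assert (Hc : 0 < M * m a) by nra.
apply (cont_uniform_limit a SB Bs (fun n => M * m a * tail n)); [apply SB_cont | | ].
- intros n x Hx; eapply Rle_trans; [apply Bs_tail, Hx | ].
  assert (H := m_le x Hx); assert (H1 := tail_ge0 n).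
  apply Rmult_le_compat_r; nra.
- intros eps Heps; destruct (tail_small (eps / (M * m a))) as [n Hn];
    [apply Rdiv_lt_0_compat; trivial | ].
  exists n; apply (Rmult_le_compat_l (M * m a)) in Hn; [ | lra].
  replace (M * m a * (eps / (M * m a))) with eps in Hn by (field; split; lra); trivial.
Qed.

Lemma E_ge0 : 0 <= E.
Proof. apply Rlt_le, exp_pos. Qed.

(* The remainder [As - SA n] is itself driven through the comparison lemma, so no
   interchange of limit and integral is needed. *)
Lemma As_spec :
  (forall x, half_open a x -> der a As x (dA As Bs x)) /\
  (forall x, half_open a x -> Cmod (As x - 1)%C <= hA E 0 x) /\
  (forall n x, half_open a x -> Cmod (As x - SA (S n) x)%C <= hA (tail n) 0 x).
Proof.
assert (HE := E_ge0).
assert (Hdh : forall N x, half_open a x -> is_derive (hA N 0) x (dhA N 0 x))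
  by (intros N x Hx; apply is_derive_hA, Hx).
assert (Hdb : forall x, half_open a x -> Cmod (dA As Bs x) <= dhA E 0 x).
{ intros x Hx; apply dA_bound; trivial; simpl pow; rewrite Rmult_1_r; [apply As_le, Hx | ].
  rewrite <- Rmult_assoc; apply Bs_le, Hx. }
destruct (primitive_exists a (dA As Bs) (hA E 0) (dhA E 0)) as [F [HF HF0]]; auto.
{ apply cont_dA; [apply As_cont | apply Bs_cont]. }
{ apply hA_vanishes. }
(* The derivative of this difference is [dA] of the two remainders of order [n], so [dA_bound]
   applies with [tail n] as constant. *)
assert (HFS : forall n x, half_open a x ->
  Cmod (F x - (SA (S n) x - 1))%C <= hA (tail n) 0 x).
{ intros n; destruct (partial_sums n) as [Hd [H0 _]].
  apply (der_bound a _ (fun x => dA As Bs x - dA (SA n) (SB n) x)%C _ (dhA (tail n) 0)); auto.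
  - intros x Hx; apply der_minus; auto.
    replace (dA (SA n) (SB n) x) with (dA (SA n) (SB n) x - 0)%C by ring.
    apply (der_minus a (SA (S n)) (fun _ => 1%C)); [apply Hd, Hx | apply der_const].
  - intros x Hx.
    replace (dA As Bs x - dA (SA n) (SB n) x)%C
      with (dA (fun x => As x - SA n x)%C (fun x => Bs x - SB n x)%C x)
      by (unfold dA; ring).
    apply dA_bound; trivial; [apply tail_ge0 | | ]; simpl pow; rewrite Rmult_1_r.
    + apply As_tail, Hx.
    + rewrite <- Rmult_assoc; apply Bs_tail, Hx.
  - intros x Hx; apply hA_ge0, tail_ge0.
  - replace (RtoC 0) with (0 - 0)%C by ring; apply (tends_minus (at_right 0)); trivial. }
(* Both functions lie within a multiple of [tail n] of [SA (S n) - 1], for every [n]. *)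
assert (EF : forall x, half_open a x -> F x = (As x - 1)%C).
{ intros x Hx; assert (Hw := w_gt0 x).
  assert (H : (As x - 1 - F x)%C = 0%C).
  { apply (Cmod_arbitrarily_small _ (1 + w x) tail); [lra | | apply tail_small].
    intros n; assert (H1 := HFS n x Hx); assert (H2 := As_tail (S n) x Hx).
    assert (H3 := tail_S n).
    replace (As x - 1 - F x)%C with ((As x - SA (S n) x) + - (F x - (SA (S n) x - 1)))%C by ring.
    eapply Rle_trans; [apply Cmod_triangle | rewrite Cmod_opp].
    replace (hA (tail n) 0 x) with (tail n * w x) in H1 by (unfold hA; simpl; field).
    lra. }
  transitivity (As x - 1 - (As x - 1 - F x))%C; [ | rewrite H]; ring. }
repeat split.
- intros x Hx; apply (der_ext a (fun x => F x + 1)%C); trivial.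
  + intros y Hy; rewrite EF by trivial; ring.
  + replace (dA As Bs x) with (dA As Bs x + 0)%C by ring.
    apply (der_plus a F (fun _ => 1%C)); [auto | apply der_const].
- intros x Hx; rewrite <- EF by trivial.
  apply (der_bound a F (dA As Bs) (hA E 0) (dhA E 0)); auto.
  intros y Hy; apply hA_ge0, HE.
- intros n x Hx; assert (H := HFS n x Hx); rewrite EF in H by trivial.
  replace (As x - SA (S n) x)%C with (As x - 1 - (SA (S n) x - 1))%C by ring; trivial.
Qed.

Lemma As_tends : tends (at_right 0) As 1.
Proof.
intros eps Heps.
generalize (filter_and (F := at_right 0) _ _ (at_right_below a a_gt0) (hA_vanishes E 0 eps Heps)).
apply filter_imp; intros x [Hx H].
rewrite <- RtoC_minus, Cmod_R, Rminus_0_r, Rabs_pos_eq in H by apply hA_ge0, E_ge0.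
eapply Rle_trans; [apply As_spec; unfold half_open; lra | exact H].
Qed.

Lemma Bs_vanishes : vanishes Bs.
Proof.
apply (tends_squeeze (at_right 0) _ (fun x => RtoC (M * E) * RtoC (m x))%C).
- generalize (at_right_below a a_gt0); apply filter_imp; intros x Hx.
  assert (HE := E_ge0); assert (Hm := m_gt0 x).
  rewrite <- RtoC_mult, Cmod_R, Rabs_pos_eq by (apply Rmult_le_pos; nra).
  eapply Rle_trans; [apply Bs_le; unfold half_open; lra | lra].
- replace (RtoC 0) with (RtoC (M * E) * 0)%C by ring.
  apply (tends_mult (at_right 0)); [apply (tends_const (at_right 0)) | apply m_vanishes].
Qed.

Lemma der_Bs x : half_open a x -> der a Bs x (dB As Bs x).
Proof.
destruct As_spec as [HdA [HbA HtA]]; destruct G_spec as [HG [HG0 _]].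
assert (Hdh : forall N x, half_open a x -> is_derive (hB N 0) x (dhB N 0 x))
  by (intros N y Hy; apply is_derive_hB, Hy).
(* [dB_bound] asks for a first component bounded by [hA], which vanishes at [0], whereas [As] tends
   to 1. The constant 1 is split off, and [G] accounts for its contribution. *)
set (A1 := fun x => (As x - 1)%C).
assert (HA1 : cont a A1).
{ apply cont_plus; [apply As_cont | apply cont_const]. }
destruct (primitive_exists a (dB A1 Bs) (hB E 0) (dhB E 0)) as [F [HF HF0]]; auto.
{ exact (cont_dB _ _ HA1 Bs_cont). }
{ intros y Hy; apply dB_bound; [exact Hy | apply E_ge0 | exact (HbA y Hy) | ].
  simpl pow; rewrite Rmult_1_r, <- Rmult_assoc; apply Bs_le, Hy. }
{ apply hB_vanishes. }
assert (HFG : forall y, half_open a y -> der a (fun y => F y + G y)%C y (dB As Bs y)).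
{ intros y Hy; replace (dB As Bs y) with (dB A1 Bs y + - (RtoC (e y) * p1 y))%C
    by (unfold dB, A1; fold (e y); ring).
  apply der_plus; auto. }
assert (HFS : forall n y, half_open a y ->
  Cmod (F y + G y - SB (S n) y)%C <= hB (tail n) 0 y).
{ intros n; destruct (partial_sums n) as [Hd [H0 H0B]].
  apply (der_bound a _ (fun y => dB As Bs y - dB (SA (S n)) (SB n) y)%C _ (dhB (tail n) 0)); auto.
  - intros y Hy; apply (der_minus a (fun y => F y + G y)%C); [auto | apply Hd, Hy].
  - intros y Hy.
    replace (dB As Bs y - dB (SA (S n)) (SB n) y)%C
      with (dB (fun x => As x - SA (S n) x)%C (fun x => Bs x - SB n x)%C y)
      by (unfold dB; ring).
    apply dB_bound; [exact Hy | apply tail_ge0 | | ].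
    + exact (HtA n y Hy).
    + simpl pow; rewrite Rmult_1_r, <- Rmult_assoc; apply Bs_tail, Hy.
  - intros y Hy; apply hB_ge0, tail_ge0.
  - replace (RtoC 0) with (0 + 0 - 0)%C by ring.
    apply (tends_minus (at_right 0)); [apply (tends_plus (at_right 0)) | ]; trivial. }
intros Hx; apply (der_ext a (fun y => F y + G y)%C); auto.
clear x Hx; intros x Hx; assert (Hw := w_gt0 x); assert (Hm := m_gt0 x).
assert (H : (Bs x - (F x + G x))%C = 0%C).
{ assert (Hc : 0 < M * m x) by nra.
  apply (Cmod_arbitrarily_small _ (M * m x * (1 + w x)) tail); [nra | | apply tail_small].
  intros n; assert (H1 := HFS n x Hx); assert (H2 := Bs_tail (S n) x Hx).
  assert (H3 := tail_S n).
  replace (Bs x - (F x + G x))%C with ((Bs x - SB (S n) x) + - (F x + G x - SB (S n) x))%C by ring.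
  eapply Rle_trans; [apply Cmod_triangle | rewrite Cmod_opp].
  replace (hB (tail n) 0 x) with (M * m x * (tail n * w x)) in H1 by (unfold hB, hA; simpl; field).
  assert (M * m x * tail (S n) <= M * m x * tail n) by (apply Rmult_le_compat_l; lra).
  lra. }
transitivity (Bs x - (Bs x - (F x + G x)))%C; [ | rewrite H]; ring.
Qed.

(** * Uniqueness and asymptotics *)

(** A solution vanishing at [0] is a fixed point of the iteration, so the comparison step improves
    its own bound from [n] to [n + 1]. The resulting bounds [w^n / n!] tend to [0]. *)
Lemma scaled_unique A B :
  (forall x, half_open a x -> der a A x (dA A B x) /\ der a B x (dB A B x)) ->
  vanishes A -> vanishes B ->
  forall N, 0 <= N ->
  (forall x, half_open a x -> Cmod (A x) <= N) ->
  (forall x, half_open a x -> Cmod (B x) <= M * (m x * N)) ->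
  forall x, half_open a x -> A x = 0%C /\ B x = 0%C.
Proof.
intros Hd HA0 HB0 N HN HA HB.
assert (Hn : forall n x, half_open a x ->
  Cmod (A x) <= N / INR (fact n) * w x ^ n /\
  Cmod (B x) <= M * (m x * (N / INR (fact n) * w x ^ n))).
{ induction n as [|n IH].
  - intros x Hx; simpl; replace (N / 1 * 1) with N by field; auto.
  - assert (HNn : 0 <= N / INR (fact n))
      by (apply Rmult_le_pos; [trivial | apply Rlt_le, inv_fact_gt0]).
    assert (Eh : forall x, hA (N / INR (fact n)) n x = N / INR (fact (S n)) * w x ^ S n).
    { intros x; unfold hA; rewrite fact_simpl, mult_INR; field.
      split; [apply INR_fact_neq_0 | apply not_0_INR; lia]. }
    assert (HA1 : forall x, half_open a x -> Cmod (A x) <= hA (N / INR (fact n)) n x).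
    { apply (der_bound a A (dA A B) _ (dhA (N / INR (fact n)) n)); trivial.
      - intros x Hx; apply Hd, Hx.
      - intros x Hx; apply is_derive_hA, Hx.
      - intros x Hx; apply dA_bound; trivial; apply IH, Hx.
      - intros x Hx; apply hA_ge0; trivial. }
    intros x Hx; rewrite <- Eh; split; [auto | ].
    apply (der_bound a B (dB A B) (hB (N / INR (fact n)) n) (dhB (N / INR (fact n)) n)); trivial.
    + intros y Hy; apply Hd, Hy.
    + intros y Hy; apply is_derive_hB, Hy.
    + intros y Hy; apply dB_bound; auto; apply IH, Hy.
    + intros y Hy; apply hB_ge0; trivial. }
intros x Hx; assert (Hm := m_gt0 x).
assert (Hsm : forall eps, 0 < eps -> exists n, w x ^ n / INR (fact n) <= eps).
{ intros eps Heps; destruct (cv_speed_pow_fact (w x) eps Heps) as [n H].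
  exists n; specialize (H n (le_n n)); unfold Rdist in H; rewrite Rminus_0_r in H.
  apply Rabs_def2 in H; lra. }
split.
- apply (Cmod_arbitrarily_small _ N (fun n => w x ^ n / INR (fact n))); trivial.
  intros n; eapply Rle_trans; [apply (Hn n x Hx) | apply Req_le; unfold Rdiv; ring].
- apply (Cmod_arbitrarily_small _ (M * m x * N) (fun n => w x ^ n / INR (fact n))); trivial.
  + apply Rmult_le_pos; [nra | trivial].
  + intros n; eapply Rle_trans; [apply (Hn n x Hx) | apply Req_le; unfold Rdiv; ring].
Qed.

Let mi x := Rpower x (- (2 * kappa + 1)).
Let c : C := (- p1 0 / RtoC (2 * kappa + 1))%C.

Lemma mi_m x : (RtoC (mi x) * RtoC (m x))%C = 1%C.
Proof. apply Rpower_opp_C. Qed.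

Hypothesis p1_0 : tends (at_right 0) p1 (p1 0).

(** In [Bs' = - (q Bs + e p1 As)] the first term is [o(e)] and [p1 As] tends to [p1 0]. Hence [Bs']
    is asymptotic to [- p1 0 * e], the derivative of [c * m], and comparison near [0] integrates
    this. *)
Lemma Bs_asymp : tends (at_right 0) (fun x => RtoC (mi x) * Bs x)%C c.
Proof.
assert (HE := E_ge0).
assert (H2k : RtoC (2 * kappa + 1) <> 0%C)
  by (intros H; apply (f_equal fst) in H; simpl in H; lra).
intros eps Heps.
assert (HpA : tends (at_right 0) (fun x => p1 x * As x)%C (p1 0)).
{ generalize (tends_mult (at_right 0) _ _ _ _ p1_0 As_tends).
  replace (p1 0 * 1)%C with (p1 0) by ring; trivial. }
(* This function times [e] is the bound on [q Bs] obtained from [q_bound] and [Bs_le]. *)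
assert (Hx1 : vanishes (fun x => RtoC (cq * M * E) * RtoC (Rpower x (1 + alpha)))%C).
{ replace (RtoC 0) with (RtoC (cq * M * E) * 0)%C by ring.
  apply (tends_mult (at_right 0)); [apply (tends_const (at_right 0)) | ].
  apply Rpower_vanishes; lra. }
destruct (filter_and (F := at_right 0) _ _ (at_right_below a a_gt0)
  (filter_and (F := at_right 0) _ _ (HpA (eps / 2) ltac:(lra)) (Hx1 (eps / 2) ltac:(lra))))
  as [d Hd].
(* [half_open d1] contains its right endpoint, which must lie strictly inside the ball of radius
   [d]. *)
set (d1 := d / 2).
assert (Hd1 : forall x, half_open d1 x -> 0 < x < a /\
  Cmod (p1 x * As x - p1 0)%C <= eps / 2 /\ cq * M * E * Rpower x (1 + alpha) <= eps / 2).
{ intros x Hx; destruct (Hd x) as [H1 [H2 H3]].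
  - change (Rabs (x - 0) < d); unfold half_open, d1 in Hx.
    generalize (cond_pos d); intros; rewrite Rabs_pos_eq; lra.
  - apply Hx.
  - split; [trivial | split; [trivial | ]].
    rewrite <- RtoC_mult, <- RtoC_minus, Cmod_R, Rminus_0_r in H3.
    eapply Rle_trans; [apply Rle_abs | exact H3]. }
assert (Hd1a : d1 <= a).
{ assert (H0 : 0 < d1) by apply is_pos_div_2.
  destruct (Hd1 d1) as [H _]; [unfold half_open; lra | lra]. }
set (D := fun x => (Bs x - c * RtoC (m x))%C).
(* The two errors in the derivative of [D] are at most [eps / 2 * e] each, so together they stay
   below the derivative of [eps * m]. *)
assert (HD : forall x, half_open d1 x -> Cmod (D x) <= eps * m x).
{ apply (der_bound d1 D
    (fun x => dB As Bs x - c * RtoC ((2 * kappa + 1) * e x))%C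
    (fun x => eps * m x) (fun x => eps * ((2 * kappa + 1) * e x))).
  - intros x Hx; assert (Hxa : half_open a x) by (unfold half_open in *; lra).
    apply (der_minus d1 Bs (fun y => c * RtoC (m y))%C); [apply (der_restrict a); [trivial | apply der_Bs, Hxa] | ].
    replace (c * RtoC ((2 * kappa + 1) * e x))%C
      with (0 * RtoC (m x) + c * RtoC ((2 * kappa + 1) * e x))%C by ring.
    apply (der_mult d1 (fun _ => c) (fun y => RtoC (m y))); [apply der_const | apply der_RtoC, is_derive_m, Hx].
  - intros x Hx; apply @is_derive_scal, is_derive_m, Hx.
  - intros x Hx; destruct (Hd1 x Hx) as [Hxa [H1 H2]].
    assert (Hxa' : half_open a x) by (unfold half_open; lra).
    assert (He : 0 < e x) by apply Rpower_gt0.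
    replace (dB As Bs x - c * RtoC ((2 * kappa + 1) * e x))%C
      with (- (q x * Bs x + RtoC (e x) * (p1 x * As x - p1 0)))%C.
    2: { unfold dB, c; fold (e x); rewrite RtoC_mult; field; trivial. }
    rewrite Cmod_opp; eapply Rle_trans; [apply Cmod_triangle | ].
    rewrite Cmod_Rmult, Cmod_mult by lra.
    assert (H3 : Cmod (q x) * Cmod (Bs x) <= cq * Rpower x alpha * (M * m x * E)).
    { apply Rmult_le_compat; try apply Cmod_ge_0; [apply q_bound | apply Bs_le]; trivial. }
    rewrite m_e in H3 by lra.
    replace (cq * Rpower x alpha * (M * (e x * x) * E))
      with (e x * (cq * M * E * Rpower x (1 + alpha))) in H3
      by (rewrite Rpower_plus, Rpower_1 by lra; ring).
    assert (H4 : e x * (cq * M * E * Rpower x (1 + alpha)) <= e x * (eps / 2))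
      by (apply Rmult_le_compat_l; lra).
    assert (H5 : e x * Cmod (p1 x * As x - p1 0)%C <= e x * (eps / 2))
      by (apply Rmult_le_compat_l; lra).
    assert (0 < eps * e x) by nra; nra.
  - intros x Hx; assert (Hm := m_gt0 x); nra.
  - replace (RtoC 0) with (0 - c * 0)%C by ring.
    apply (tends_minus (at_right 0)); [apply Bs_vanishes | ].
    apply (tends_mult (at_right 0)); [apply (tends_const (at_right 0)) | apply m_vanishes]. }
generalize (at_right_below d1 (is_pos_div_2 d)); apply filter_imp; intros x Hx.
assert (Hx' : half_open d1 x) by (unfold half_open; lra).
replace (RtoC (mi x) * Bs x - c)%C with (RtoC (mi x) * D x)%C.
- assert (Hmi : 0 < mi x) by apply Rpower_gt0.
  rewrite Cmod_Rmult by lra.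
  apply Rle_trans with (mi x * (eps * m x)); [apply Rmult_le_compat_l; [lra | auto] | ].
  apply Req_le; transitivity (eps * (mi x * m x)); [ring | ].
  assert (Em : mi x * m x = 1) by (generalize (f_equal fst (mi_m x)); simpl; lra).
  rewrite Em; ring.
- unfold D; transitivity (RtoC (mi x) * Bs x - c * (RtoC (mi x) * RtoC (m x)))%C;
    [ | rewrite mi_m]; ring.
Qed.

Hypothesis p1_0_neq0 : p1 0 <> 0%C.

Let fq x : C := (RtoC (Rpower x kappa) * As x)%C.
Let gq x : C := (RtoC (Rpower x (- kappa)) * Bs x)%C.

Lemma c_neq0 : c <> 0%C.
Proof.
assert (H2k : RtoC (2 * kappa + 1) <> 0%C)
  by (intros H; apply (f_equal fst) in H; simpl in H; lra).
intros H; apply p1_0_neq0.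
transitivity (- c * RtoC (2 * kappa + 1))%C; [unfold c; field; trivial | rewrite H; ring].
Qed.

Lemma mi_kappa x : RtoC (mi x) = (RtoC (Rpower x (- (kappa + 1))) * RtoC (Rpower x (- kappa)))%C.
Proof.
unfold mi; rewrite <- RtoC_mult, <- Rpower_plus; do 2 f_equal; ring.
Qed.

Lemma fq_asymp : asymp0 fq (fun x => RtoC (Rpower x kappa)).
Proof.
apply (asymp0_ext (fun x => 1 * RtoC (Rpower x kappa))%C); [intros; ring | ].
apply asymp0_tends; [intros H; apply (f_equal fst) in H; simpl in H; lra | ].
apply (tends_ext (at_right 0) As); [ | apply As_tends].
apply filter_forall; intros x; unfold fq.
transitivity (RtoC (Rpower x (- kappa)) * RtoC (Rpower x kappa) * As x)%C;
  [rewrite Rpower_opp_C | ]; ring.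
Qed.

Lemma gq_asymp : asymp0 gq (fun x => c * RtoC (Rpower x (kappa + 1)))%C.
Proof.
apply asymp0_tends; [apply c_neq0 | ].
apply (tends_ext (at_right 0) (fun x => RtoC (mi x) * Bs x)%C); [ | apply Bs_asymp].
apply filter_forall; intros x; unfold gq; rewrite mi_kappa; ring.
Qed.

Lemma fq_gq_solution : is_dirac_solution a kappa p1 p2 q fq gq.
Proof.
apply (dirac_of_scaled a kappa p1 p2 q As Bs); trivial.
- apply As_spec.
- apply der_Bs.
Qed.

(** Both scaled solutions have the same leading coefficients, so for their difference [A] and
    [B / m] tend to [0]. Being continuous on (0, a], these quotients are bounded, which is the
    initial bound that [scaled_unique] requires. *)
Lemma fq_gq_unique u v :
  is_dirac_solution a kappa p1 p2 q u v ->
  asymp0 u (fun x => RtoC (Rpower x kappa)) ->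
  asymp0 v (fun x => c * RtoC (Rpower x (kappa + 1)))%C ->
  forall x, half_open a x -> u x = fq x /\ v x = gq x.
Proof.
intros Hsol Hu Hv.
assert (H1 : RtoC 1 <> 0%C) by (intros H; apply (f_equal fst) in H; simpl in H; lra).
apply (asymp0_ext _ (fun x => 1 * RtoC (Rpower x kappa))%C) in Hu; [ | intros; ring].
apply asymp0_tends in Hu; trivial.
apply asymp0_tends in Hv; [ | apply c_neq0].
assert (Hd := scaled_of_dirac a kappa p1 p2 q u v Hsol); cbv zeta in Hd.
set (Au := fun x => (RtoC (Rpower x (- kappa)) * u x)%C) in *.
set (Bu := fun x => (RtoC (Rpower x kappa) * v x)%C) in *.
set (A := fun x => (Au x - As x)%C); set (B := fun x => (Bu x - Bs x)%C).
assert (HdAB : forall x, half_open a x -> der a A x (dA A B x) /\ der a B x (dB A B x)).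
{ intros x Hx; destruct (Hd x Hx) as [HA HB]; split.
  - replace (dA A B x) with (dA Au Bu x - dA As Bs x)%C by (unfold dA, A, B; ring).
    apply der_minus; [trivial | apply As_spec, Hx].
  - replace (dB A B x) with (dB Au Bu x - dB As Bs x)%C by (unfold dB, A, B; ring).
    apply der_minus; [trivial | apply der_Bs, Hx]. }
assert (HA0 : vanishes A).
{ replace (RtoC 0) with (1 - 1)%C by ring.
  apply (tends_minus (at_right 0)); [trivial | apply As_tends]. }
assert (HBm : vanishes (fun x => RtoC (mi x) * B x)%C).
{ apply (tends_ext (at_right 0)
    (fun x => RtoC (Rpower x (- (kappa + 1))) * v x - RtoC (mi x) * Bs x)%C).
  - apply filter_forall; intros x; unfold B, Bu; rewrite mi_kappa.
    transitivity (RtoC (Rpower x (- (kappa + 1)))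
      * (RtoC (Rpower x (- kappa)) * RtoC (Rpower x kappa)) * v x
      - RtoC (Rpower x (- (kappa + 1))) * RtoC (Rpower x (- kappa)) * Bs x)%C;
      [rewrite Rpower_opp_C | ]; ring.
  - replace (RtoC 0) with (c - c)%C by ring.
    apply (tends_minus (at_right 0)); [trivial | apply Bs_asymp]. }
assert (EB : forall x, B x = (RtoC (m x) * (RtoC (mi x) * B x))%C).
{ intros x; transitivity (RtoC (mi x) * RtoC (m x) * B x)%C; [rewrite mi_m | ]; ring. }
assert (HB0 : vanishes B).
{ apply (tends_ext (at_right 0) (fun x => RtoC (m x) * (RtoC (mi x) * B x))%C).
  - apply filter_forall; intros x; symmetry; apply EB.
  - replace (RtoC 0) with (0 * 0)%C by ring.
    apply (tends_mult (at_right 0)); [apply m_vanishes | trivial]. }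
assert (HcA : cont a A) by (apply (der_cont _ _ (dA A B)); apply HdAB).
assert (HcB : cont a B) by (apply (der_cont _ _ (dB A B)); apply HdAB).
destruct (cont_bounded a A 0 a_gt0 HcA HA0) as [N1 [HN1 HbA]].
destruct (cont_bounded a (fun x => RtoC (mi x) * B x)%C 0 a_gt0) as [N2 [HN2 HbB]]; trivial.
{ apply cont_mult; [apply cont_Rpower | trivial]. }
assert (HN2M : 0 < N2 / M) by (apply Rdiv_lt_0_compat; trivial).
assert (H0 : forall x, half_open a x -> A x = 0%C /\ B x = 0%C).
(* One constant must serve both bounds: [N1] bounds [A], and dividing [N2] by [M] offsets the factor
   [M] in the bound required of [B]. *)
{ apply (scaled_unique A B HdAB HA0 HB0 (N1 + N2 / M)); [lra | | ].
  - intros x Hx; specialize (HbA x Hx); lra.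
  - intros x Hx; assert (Hm := m_gt0 x); rewrite EB, Cmod_Rmult by lra.
    apply Rle_trans with (m x * N2); [apply Rmult_le_compat_l; [lra | auto] | ].
    replace (M * (m x * (N1 + N2 / M))) with (m x * (M * N1) + m x * N2) by (field; lra).
    assert (0 < M * N1) by nra; nra. }
intros x Hx; destruct (H0 x Hx) as [HA HB].
split.
- transitivity (RtoC (Rpower x (- kappa)) * RtoC (Rpower x kappa) * u x)%C;
    [rewrite Rpower_opp_C; ring | ].
  transitivity (RtoC (Rpower x kappa) * (A x + As x))%C; [unfold A, Au | rewrite HA; unfold fq]; ring.
- transitivity (RtoC (Rpower x (- kappa)) * RtoC (Rpower x kappa) * v x)%C;
    [rewrite Rpower_opp_C; ring | ].
  transitivity (RtoC (Rpower x (- kappa)) * (B x + Bs x))%C; [unfold B, Bu | rewrite HB; unfold gq]; ring.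
Qed.

Lemma is_seriesC_mult (z : C) (s : nat -> C) l :
  is_seriesC s l -> is_seriesC (fun n => z * s n)%C (z * l)%C.
Proof.
intros H; apply (proj2 (tends_filterlim eventually (sum_nC s) l)) in H.
apply (proj1 (tends_filterlim eventually _ _)).
apply (tends_ext eventually (fun n => z * sum_nC s n)%C).
- apply filter_forall; intros n.
  induction n as [|n IH]; [rewrite !sum_O; trivial | ].
  rewrite !sum_nC_S, <- IH; ring.
- apply (tends_mult eventually); [apply (tends_const eventually) | trivial].
Qed.

Lemma fq_gq_series x : half_open a x ->
  is_seriesC (fun n => RtoC (/ INR (fact n)) * X n x)%C (fq x) /\
  is_seriesC (fun n => RtoC (/ INR (fact n)) * Y n x)%C (gq x).
Proof.
intros Hx; split.
- apply (is_series_ext (fun n => RtoC (Rpower x kappa) * An n x)%C).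
  + intros n; rewrite X_An, RtoC_inv by apply INR_fact_neq_0.
    (* The equality is stated in the carrier of the normed module; restating it in [C] lets [field]
       recognise it. *)
    match goal with |- ?l = ?r => change (@eq C l r) end.
    change (RtoC (Rpower x kappa)) with (f x); field; apply fact_neq0C.
  + apply is_seriesC_mult, As_series, Hx.
- apply (is_series_ext (fun n => RtoC (Rpower x (- kappa)) * Bn n x)%C).
  + intros n; rewrite Y_Bn, RtoC_inv by apply INR_fact_neq_0.
    match goal with |- ?l = ?r => change (@eq C l r) end.
    replace (RtoC (Rpower x (- kappa))) with (/ f x)%C.
    * field; nz.
    * transitivity (RtoC (Rpower x (- kappa)) * RtoC (Rpower x kappa) * / f x)%C;
        [rewrite Rpower_opp_C; ring | ].
      change (RtoC (Rpower x kappa)) with (f x); field; apply f_neq0.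
  + apply is_seriesC_mult, Bs_series, Hx.
Qed.

(** With [p2 = q = 0] the scaled system reduces to [A' = 0] and [B' = - e p1 A], which [(1, G)]
    solves. *)
Lemma f0_g0_solution :
  is_dirac_solution a kappa p1 (fun _ => RtoC 0) (fun _ => RtoC 0) f g.
Proof.
apply (dirac_of_scaled a kappa p1 _ _ (fun _ => 1%C) G); trivial; try apply cont_const.
- intros x Hx; unfold dA.
  replace (0 * 1 + RtoC (Rpower x (- (2 * kappa))) * 0 * G x)%C with (RtoC 0) by ring.
  apply der_const.
- intros x Hx; unfold dB.
  replace (- (0 * G x + RtoC (Rpower x (2 * kappa)) * p1 x * 1))%C
    with (- (RtoC (e x) * p1 x))%C by (unfold e; ring).
  apply G_spec, Hx.
- intros x Hx; unfold f, f0; ring.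
- intros x Hx; unfold g, g0, G; ring.
Qed.

End Dirac.

Theorem proposition2p10 :
  forall (a kappa : R) (p1 p2 q : R -> C) (cq alpha : R),
    0 < a ->
    1 / 2 <= kappa ->
    continuous_onC (closed_itv a) p1 ->
    continuous_onC (closed_itv a) p2 ->
    p1 0 <> RtoC 0 ->
    continuous_onC (half_open a) q ->
    0 < cq ->
    -1 < alpha <= 0 ->
    (forall x, half_open a x -> Cmod (q x) <= cq * Rpower x alpha) ->
    is_dirac_solution a kappa p1 (fun _ => RtoC 0) (fun _ => RtoC 0)
      (f0 kappa) (g0 kappa p1) /\
    exists fq gq : R -> C,
      (is_dirac_solution a kappa p1 p2 q fq gq /\
       asymp0 fq (fun x => RtoC (Rpower x kappa)) /\
       asymp0 gq (fun x => - p1 0 / RtoC (2 * kappa + 1)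
                             * RtoC (Rpower x (kappa + 1)))%C) /\
      (forall u v : R -> C,
         is_dirac_solution a kappa p1 p2 q u v ->
         asymp0 u (fun x => RtoC (Rpower x kappa)) ->
         asymp0 v (fun x => - p1 0 / RtoC (2 * kappa + 1)
                              * RtoC (Rpower x (kappa + 1)))%C ->
         forall x, half_open a x -> u x = fq x /\ v x = gq x) /\
      (forall x, half_open a x ->
         @is_series R_AbsRing C_R_NormedModule
           (fun n => (RtoC (/ INR (fact n))
              * Xhat (f0 kappa) (g0 kappa p1) p2 q n x)%C) (fq x) /\
         @is_series R_AbsRing C_R_NormedModule
           (fun n => (RtoC (/ INR (fact n))
              * Yhat (f0 kappa) (g0 kappa p1) p2 q n x)%C) (gq x)).
Proof.
intros a kappa p1 p2 q cq alpha Ha Hk Hp1 Hp2 Hp10 Hq Hcq Halpha Hqb.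
(* Continuity on the closed interval is used in two forms: continuity on (0, a], for the calculus
   relative to that set, and the limit at [0], for boundedness and for the leading coefficient of
   the second component. *)
assert (Hco : forall p, continuous_onC (closed_itv a) p -> cont a p /\ tends (at_right 0) p (p 0)).
{ intros p Hp; split.
  - apply cont_onC; intros x Hx P HP.
    generalize (Hp x ltac:(unfold half_open, closed_itv in *; lra) P HP).
    apply (filter_imp (F := @locally R_UniformSpace x)); intros y Hy Hya.
    apply Hy; unfold half_open, closed_itv in *; lra.
  - apply tends_filterlim; [apply _ | intros P HP].
    generalize (filter_and (F := @locally R_UniformSpace 0) _ _ (at_right_below a Ha)
      (Hp 0 ltac:(unfold closed_itv; lra) P HP)).
    apply (filter_imp (F := @locally R_UniformSpace 0)); intros y [Hy1 Hy2] Hy.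
    apply Hy2; unfold closed_itv; specialize (Hy1 Hy); lra. }
destruct (Hco p1 Hp1) as [Hc1 Ht1]; destruct (Hco p2 Hp2) as [Hc2 Ht2].
apply cont_onC in Hq.
destruct (cont_bounded a p1 _ Ha Hc1 Ht1) as [M1 [HM1 Hb1]].
destruct (cont_bounded a p2 _ Ha Hc2 Ht2) as [M2 [HM2 Hb2]].
(* The sum is a common bound for [p1] and [p2], as the section works with a single constant. *)
set (M := M1 + M2); assert (HM : 0 < M) by (unfold M; lra).
assert (Hb1' : forall x, half_open a x -> Cmod (p1 x) <= M)
  by (intros x Hx; unfold M; specialize (Hb1 x Hx); lra).
assert (Hb2' : forall x, half_open a x -> Cmod (p2 x) <= M)
  by (intros x Hx; unfold M; specialize (Hb2 x Hx); lra).
split; [apply (f0_g0_solution a kappa p1 alpha M); assumption | ].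
exists (fun x => RtoC (Rpower x kappa) * As kappa p1 p2 q x)%C.
exists (fun x => RtoC (Rpower x (- kappa)) * Bs kappa p1 p2 q x)%C.
split; [split; [ | split] | split].
- apply (fq_gq_solution a kappa p1 p2 q cq alpha M); assumption.
- apply (fq_asymp a kappa p1 p2 q cq alpha M); assumption.
- apply (gq_asymp a kappa p1 p2 q cq alpha M); assumption.
- apply (fq_gq_unique a kappa p1 p2 q cq alpha M); assumption.
- apply (fq_gq_series a kappa p1 p2 q cq alpha M); assumption.
Qed.
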